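(* Let $(\mathbb X,\mathrm{dist}_{\mathbb X})$ be a compact Ahlfors $d$-regular length space and $K\colon\mathbb X\times\mathbb X\to\mathbb R$ a continuous, symmetric, positive definite kernel. Then there is a constant $c>0$, depending only on $\mathbb X$ and $K$, such that for every $\mu\in\mathcal P(\mathbb X)$ and every $L\ge1$, $$\min_{\nu\in\mathcal P^{\mathrm{Acurve}}_L(\mathbb X)}\mathscr D_K(\mu,\nu)\le\min_{\nu\in\mathcal P^{\mathrm{Lcurve}}_L(\mathbb X)}\mathscr D_K(\mu,\nu)\le c\,L^{-\frac{d}{3d-2}}.$$
   Context: $\mathbb X$ is a compact metric space with a finite nonnegative Borel measure $\sigma_{\mathbb X}$ of full support. Ahlfors $d$-regular: $\sigma_{\mathbb X}(B_r(x))\sim r^d$ for all $x\in\mathbb X$, $0<r\le\mathrm{diam}(\mathbb X)$, with constants independent of $x,r$ ($B_r(x)$ the closed ball). Length space: $\mathrm{dist}_{\mathbb X}(x,y)$ equals the infimum of lengths of continuous curves joining $x,y$. $\mathcal P(\mathbb X)$: Borel probability measures. Discrepancy: $\mathscr D_K(\mu,\nu)=\sup_{\|\varphi\|_{H_K(\mathbb X)}\le1}|\int\varphi\,d(\mu-\nu)|$ with $H_K(\mathbb X)$ the reproducing kernel Hilbert space of $K$; equivalently $\mathscr D_K^2(\mu,\nu)=\iint K\,d\mu\,d\mu-2\iint K\,d\mu\,d\nu+\iint K\,d\nu\,d\nu$. $\mathrm{Lip}(\mathbb X)$ is the set of Lipschitz continuous $\gamma\colon[0,1]\to\mathbb X$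 with $\gamma(0)=\gamma(1)$, and $L(\gamma)$ is the smallest Lipschitz constant. $\lambda$ is Lebesgue measure on $[0,1]$ and $\gamma_*\omega(B)=\omega(\gamma^{-1}(B))$. $\mathcal P^{\mathrm{Acurve}}_L(\mathbb X)=\{\gamma_*(\rho\lambda):\gamma\in\mathrm{Lip}(\mathbb X),\,L(\gamma)\le L,\ \rho\lambda\in\mathcal P([0,1]),\ \rho\text{ Lipschitz with }L(\rho)\le L\}$ and $\mathcal P^{\mathrm{Lcurve}}_L(\mathbb X)=\{\gamma_*\lambda:\gamma\in\mathrm{Lip}(\mathbb X),\,L(\gamma)\le L\}$. *)

(* Defs.v *)
From HB Require Import structures.
From mathcomp Require Import all_boot all_order all_algebra.
From mathcomp Require Import all_classical all_reals all_analysis.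
Set Implicit Arguments. Unset Strict Implicit. Unset Printing Implicit Defensive.
Import Order.TTheory GRing.Theory Num.Theory.
Import numFieldNormedType.Exports.
Local Open Scope classical_set_scope.
Local Open Scope ring_scope.

Section Defs.
Context {R : realType} {X : Type}.
Variable dist : X -> X -> R.

Definition is_metric : Prop :=
  [/\ forall x y, 0 <= dist x y,
      forall x y, dist x y = 0 <-> x = y,
      forall x y, dist x y = dist y x &
      forall x y z, dist x z <= dist x y + dist y z].

Definition dopen_ball (x : X) (r : R) : set X := [set y | dist x y < r].
Definition dclosed_ball (x : X) (r : R) : set X := [set y | dist x y <= r].

Definition dopen (A : set X) : Prop :=
  forall x, A x -> exists2 r : R, 0 < r & dopen_ball x r `<=` A.

Definition dcompact : Prop :=
  forall (I : Type) (U : I -> set X), (forall i, dopen (U i)) ->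
    setT `<=` \bigcup_i U i ->
    exists J : set I, finite_set J /\ setT `<=` \bigcup_(i in J) U i.

Definition diam : R := sup [set dist x y | x in [set: X] & y in [set: X]].

Definition unit_itv : set R := [set t | 0 <= t <= 1].

Definition dcontinuous_curve (c : R -> X) : Prop :=
  forall t, unit_itv t -> forall e : R, 0 < e -> exists2 del : R, 0 < del &
    forall s, unit_itv s -> `|s - t| < del -> dist (c s) (c t) < e.

Definition curve_length (c : R -> X) : \bar R :=
  ereal_sup [set z | exists (n : nat) (t : nat -> R),
     [/\ t 0%N = 0, t n = 1, (forall i, (i < n)%N -> t i <= t i.+1) &
          z = (\sum_(i < n) dist (c (t i)) (c (t i.+1)))%:E]].

Definition length_space : Prop :=
  forall x y, (dist x y)%:E =
    ereal_inf [set curve_length c | c in [set c | dcontinuous_curve c /\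
                                                  c 0 = x /\ c 1 = y]].

Definition lip_closed_curve (L : R) (g : R -> X) : Prop :=
  g 0 = g 1 /\
  forall s t, unit_itv s -> unit_itv t -> dist (g s) (g t) <= L * `|s - t|.

End Defs.

Section Meas.
Context {R : realType} {d0 : measure_display} {X : measurableType d0}.
Variable dist : X -> X -> R.

Local Open Scope ereal_scope.

Definition ahlfors_regular (sigma : set X -> \bar R) (d : R) : Prop :=
  exists C1 C2 : R, (0 < C1)%R /\ (0 < C2)%R /\
   forall x r, (0 < r)%R -> (r <= diam dist)%R ->
     (C1 * r `^ d)%:E <= sigma (dclosed_ball dist x r) /\
     sigma (dclosed_ball dist x r) <= (C2 * r `^ d)%:E.

Definition full_support (sigma : set X -> \bar R) : Prop :=
  forall A, dopen dist A -> A !=set0 -> 0 < sigma A.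

Definition borel_of_dist : Prop :=
  @measurable d0 X = <<s [set A | dopen dist A] >>.

Definition continuous_kernel (K : X -> X -> R) : Prop :=
  forall x y (e : R), (0 < e)%R -> exists2 del : R, (0 < del)%R &
    forall x' y', (dist x x' < del)%R -> (dist y y' < del)%R ->
      (`|K x' y' - K x y| < e)%R.

Definition symmetric_kernel (K : X -> X -> R) : Prop := forall x y, K x y = K y x.

Definition pos_def_kernel (K : X -> X -> R) : Prop :=
  forall (n : nat) (x : 'I_n -> X) (a : 'I_n -> R),
    (0 <= \sum_(i < n) \sum_(j < n) a i * a j * K (x i) (x j))%R.

Definition kint (K : X -> X -> R) (mu nu : probability X R) : R :=
  fine (\int[mu]_x \int[nu]_y (K x y)%:E).

Definition discrepancy (K : X -> X -> R) (mu nu : probability X R) : R :=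
  Num.sqrt (kint K mu mu - 2 * kint K mu nu + kint K nu nu)%R.

Definition Acurve (L : R) (nu : probability X R) : Prop :=
  exists (g : R -> X) (rho : R -> R),
    lip_closed_curve dist L g /\
    (forall s t, unit_itv s -> unit_itv t -> (`|rho s - rho t| <= L * `|s - t|)%R) /\
    (forall B : set R, measurable B -> B `<=` unit_itv ->
        0 <= \int[lebesgue_measure]_(t in B) (rho t)%:E) /\
    \int[lebesgue_measure]_(t in unit_itv) (rho t)%:E = 1 /\
    forall B : set X, measurable B ->
      nu B = \int[lebesgue_measure]_(t in unit_itv `&` g @^-1` B) (rho t)%:E.

Definition Lcurve (L : R) (nu : probability X R) : Prop :=
  exists g : R -> X, lip_closed_curve dist L g /\
    forall B : set X, measurable B ->
      nu B = lebesgue_measure (unit_itv `&` g @^-1` B).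

End Meas.

(* Main.v *)
(* Existence of minimisers is a compactness argument along an ultrafilter: Lipschitz
   curves and densities converge uniformly on [0,1], and the discrepancy is continuous
   for this convergence.

   For the rate, fix N.  A deterministic greedy choice (kernel herding) yields points
   x_1, ..., x_N with squared discrepancy O(1/N) between mu and their empirical measure,
   because the cross term of the squared norm averages to zero under mu and can hence be
   kept nonpositive.  A maximal eps-separated set with eps = N^(-1/d) has O(N) points by
   Ahlfors regularity, and its points at distance <= 3 eps form a connected graph since
   the space is a length space.  A closed walk through this graph, with detours to the
   x_k and about sqrt N idle steps at each of them, has O(N^(3/2)) steps of length
   <= 3 eps; run at one step per unit of time and rescaled to [0,1], it gives a closed
   curve of Lipschitz constant L = O(N^(3/2 - 1/d)) which travels only a fraction
   O(N^(-1/2)) of the time.  So the squared discrepancy is O(1/N), and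
   N^(-1/2) ~ L^(-d/(3d-2)).  Where the exponent of N is not positive (d <= 2/3) the
   bound is trivial.

   All discrepancy estimates are reduced to a finite quadratic form by cutting the space
   into finitely many small cells. *)
Require Import Defs.
From HB Require Import structures.
From mathcomp Require Import all_boot all_order all_algebra.
From mathcomp Require Import all_classical all_reals all_analysis.
From mathcomp Require Import measurable_realfun.
From mathcomp Require Import ring lra zify.
Set Implicit Arguments. Unset Strict Implicit. Unset Printing Implicit Defensive.
Import Order.TTheory GRing.Theory Num.Theory.
Import numFieldNormedType.Exports.
Local Open Scope classical_set_scope.
Local Open Scope ring_scope.

(** * Limits along an ultrafilter *)

Section Ultralimit.
Context {R : realType}.
Variable U : set_system nat.
Hypothesis UU : UltraFilter U.
Hypothesis U_infty : forall k : nat, U [set n | (k <= n)%N].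

(** Convergence along [U] stands in for extracted subsequences: one [U] serves all times t at once,
    so no diagonal argument arises. *)
Definition ulimit {Y : Type} (dist : Y -> Y -> R) (u : nat -> Y) (y : Y) :=
  forall e, 0 < e -> U [set n | dist (u n) y < e].

Lemma ultra_small (e : R) : 0 < e -> U [set n | n.+1%:R^-1 < e].
Proof.
move=> e0; apply: filterS (U_infty (Num.truncn e^-1)) => n /= hn.
rewrite invf_plt ?posrE ?ltr0n//.
have e1 : 0 <= e^-1 by rewrite invr_ge0 ltW.
have /andP[_ h] := truncn_itv e1.
by rewrite (lt_le_trans h)// ler_nat ltnS.
Qed.

(** An ultrafilter is prime: either [A i] belongs to [U], or its complement does and intersecting
    with it removes that piece from the finite union. *)
Lemma ultra_has (I : eqType) (s : seq I) (A : I -> set nat) :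
  U [set n | exists2 i, i \in s & A i n] -> exists2 i, i \in s & U (A i).
Proof.
elim: s => [|i s IHs] h.
  by have [n [j]] := filter_ex h; rewrite in_nil.
have [UA|UA] := in_ultra_setVsetC (A i) UU; first by exists i; rewrite ?mem_head.
have [|j js Uj] := IHs; last by exists j; rewrite // inE js orbT.
apply: filterS (filterI h UA) => n [[j]]; rewrite inE => /predU1P[->|js] //.
by move=> Aj _; exists j.
Qed.

(** If every x had a ball whose visiting times are not in [U], a finite subcover by such balls would
    contradict [ultra_has]. *)
Lemma ulimit_compact {X : choiceType} (dist : X -> X -> R) (u : nat -> X) :
  is_metric dist -> dcompact dist -> exists x, ulimit dist u x.
Proof.
move=> [d0 dxx dsym dtri] cX; apply: contrapT => /forallNP nolim.
have {}nolim x : exists e, 0 < e /\ ~ U [set n | dist (u n) x < e].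
  move: (nolim x) => /existsNP[e /not_implyP[e0 h]].
  by exists e.
have [e he] := choice nolim.
have [||J [/finite_seqP[s ->] sJ]] := cX X (fun x => dopen_ball dist x (e x)).
- move=> x y /= xy; exists (e x - dist x y); first by rewrite subr_gt0.
  by move=> z; rewrite /dopen_ball /= => yz; have := dtri x y z; lra.
- by move=> x _; exists x => //=; rewrite /dopen_ball/= (dxx _ _).2// (he x).1.
have [|x _] := @ultra_has X s (fun x => [set n | dist (u n) x < e x]).
  apply: filterS filterT => n _ /=.
  by have [x xs hx] := sJ (u n) I; exists x; rewrite // dsym.
exact: (he x).2.
Qed.

(** The limit is the supremum of the levels that lie below [u n] for [U]-many n. *)
Lemma ulimit_real (u : nat -> R) (M : R) :
  (forall n, `|u n| <= M) -> exists x, ulimit (fun a b => `|a - b|) u x.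
Proof.
move=> uM; pose S := [set a | U [set n | a <= u n]].
have S0 : S (- M).
  by apply: filterS filterT => n _ /=; have := uM n; rewrite ler_norml => /andP[].
have Sub : ubound S M.
  move=> a /filter_ex[n /= an]; apply: le_trans an _.
  by have := uM n; rewrite ler_norml => /andP[].
have supS : has_sup S by split; [exists (- M)|exists M].
exists (sup S) => e e0.
have [a Sa ha] := sup_adherent e0 supS.
have nS : ~ S (sup S + e / 2).
  by move=> /(ub_le_sup supS.2); lra.
have [//|h] := in_ultra_setVsetC [set n | sup S + e / 2 <= u n] UU.
apply: filterS (filterI Sa h) => n /= [an /negP]; rewrite -ltNge => hn.
rewrite ltr_norml; lra.
Qed.

Section Limits.
Context {Y : Type} (dist : Y -> Y -> R).
Hypotheses (dsym : forall x y, dist x y = dist y x)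
  (dtri : forall x y z, dist x z <= dist x y + dist y z).

Lemma ulimit_dist_le (u v : nat -> Y) (x y : Y) (c : R) :
  ulimit dist u x -> ulimit dist v y ->
  (forall e, 0 < e -> U [set n | dist (u n) (v n) <= c + e]) -> dist x y <= c.
Proof.
move=> ux vy uv; apply/ler_addgt0Pr => e e0.
have e3 : 0 < e / 3 by lra.
have [n [/= h1 [h2 h3]]] := filter_ex (filterI (ux _ e3) (filterI (vy _ e3) (uv _ e3))).
have := dtri x (u n) y; have := dtri (u n) (v n) y; rewrite (dsym x (u n)); lra.
Qed.

Variables (L : R) (g : nat -> R -> Y) (f : R -> Y).
Hypotheses (L0 : 0 <= L)
  (gL : forall n s t, unit_itv s -> unit_itv t ->
     dist (g n s) (g n t) <= L * `|s - t|)
  (gf : forall t, unit_itv t -> ulimit dist (g ^~ t) (f t)).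

Lemma ulimit_lipschitz s t : unit_itv s -> unit_itv t ->
  dist (f s) (f t) <= L * `|s - t|.
Proof.
move=> us ut; apply: (ulimit_dist_le (gf us) (gf ut)) => e e0.
by apply: filterS filterT => n _ /=; rewrite (le_trans (gL _ us ut))// lerDl ltW.
Qed.

(** Pointwise convergence of equi-Lipschitz maps is uniform: the finitely many grid points of mesh
    1/(m+1), with L/(m+1) <= e/3, control all t. *)
Lemma ulimit_uniform e : 0 < e ->
  U [set n | forall t, unit_itv t -> dist (g n t) (f t) <= e].
Proof.
move=> e0; have e3 : 0 < e / 3 by lra.
pose m := Num.truncn (L / (e / 3)).
have m0 : 0 < m.+1%:R :> R by rewrite ltr0n.
have Lm : L / m.+1%:R <= e / 3.
  rewrite ler_pdivrMr// mulrC -ler_pdivrMr//.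
  by have /andP[_ /ltW] := truncn_itv (divr_ge0 L0 (ltW e3)).
have ugrid (k : 'I_m.+2) : unit_itv (k%:R / m.+1%:R : R).
  rewrite /unit_itv/= divr_ge0//= ler_pdivrMr// mul1r ler_nat.
  by case: k => k /=; rewrite ltnS.
have : \forall n \near U, forall k : 'I_m.+2,
    dist (g n (k%:R / m.+1%:R)) (f (k%:R / m.+1%:R)) < e / 3.
  by apply: filter_forall => k; exact: gf (ugrid k) _ e3.
apply: filterS => n hn t ut.
have t0 : 0 <= t * m.+1%:R by rewrite mulr_ge0//; case/andP: ut.
have /andP[k1 k2] := truncn_itv t0.
have km : (Num.truncn (t * m.+1%:R) < m.+2)%N.
  rewrite ltnS -(ler_nat R) (le_trans k1)// ler_piMl ?ler0n//.
  by case/andP: ut.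
pose k := Ordinal km.
have kt : `|t - k%:R / m.+1%:R| <= m.+1%:R^-1.
  have -> : t - k%:R / m.+1%:R = (t * m.+1%:R - k%:R) / m.+1%:R.
    by rewrite mulrBl mulfK ?gt_eqF.
  rewrite normrM [X in _ * X]ger0_norm ?invr_ge0 ?ler0n//.
  rewrite ler_piMl ?invr_ge0 ?ler0n// ler_norml.
  by move: k1 k2; rewrite -[X in _ < X]natr1/=; lra.
have h1 := gL n ut (ugrid k); have h2 := ulimit_lipschitz (ugrid k) ut.
have h3 : L * `|t - k%:R / m.+1%:R| <= e / 3.
  by apply: le_trans Lm; rewrite ler_wpM2l.
rewrite distrC in h2.
have := dtri (g n t) (g n (k%:R / m.+1%:R)) (f t).
have := dtri (g n (k%:R / m.+1%:R)) (f (k%:R / m.+1%:R)) (f t).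
by have := hn k; lra.
Qed.

End Limits.

End Ultralimit.

Lemma free_ultrafilter : exists U : set_system nat,
  UltraFilter U /\ forall k : nat, U [set n | (k <= n)%N].
Proof.
have [U [UU sU]] := ultraFilterLemma eventually_filter.
by exists U; split => // k; apply: sU; exists k.
Qed.

(** * Geodesics *)

Section Geodesic.
Context {R : realType} {X : choiceType}.
Variable dist : X -> X -> R.
Hypotheses (Hm : is_metric dist) (cX : dcompact dist) (lX : length_space dist).

Let d0 x y : 0 <= dist x y. Proof. by have [h _ _ _] := Hm. Qed.
Let dxx x : dist x x = 0. Proof. by have [_ h _ _] := Hm; apply/h. Qed.
Let dsym x y : dist x y = dist y x. Proof. by have [_ _ h _] := Hm. Qed.
Let dtri x y z : dist x z <= dist x y + dist y z.
Proof. by have [_ _ _ h] := Hm. Qed.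

Lemma curve_length_ge3 (c : R -> X) s t : 0 <= s -> s <= t -> t <= 1 ->
  ((dist (c 0) (c s) + dist (c s) (c t) + dist (c t) (c 1))%:E <= curve_length dist c)%E.
Proof.
move=> s0 st t1; apply: ereal_sup_ubound.
(* The default value 1 of [nth] supplies the last partition point. *)
exists 3%N, (fun i => nth 1 [:: 0; s; t] i); split => //.
  by case=> [|[|[|]]].
by rewrite !big_ord_recr big_ord0 /= add0r.
Qed.

Lemma almost_shortest x y e : 0 < e -> exists c, [/\ dcontinuous_curve dist c,
  c 0 = x, c 1 = y & (curve_length dist c <= (dist x y + e)%:E)%E].
Proof.
move=> e0; pose S := [set curve_length dist c | c in
  [set c | dcontinuous_curve dist c /\ c 0 = x /\ c 1 = y]].
have fS : ereal_inf S \is a fin_num by rewrite -lX.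
have [_ [c [cc [c0 c1]] <-]] := lb_ereal_inf_adherent e0 fS.
by rewrite -lX -EFinD => /ltW h; exists c.
Qed.

Lemma curve_ivt x (c : R -> X) v : dcontinuous_curve dist c -> c 0 = x ->
  0 <= v <= dist x (c 1) -> exists2 t, unit_itv t & dist x (c t) = v.
Proof.
(* Clamping the time to [0,1] extends the curve continuously to the whole line, where [IVT]
   applies. *)
move=> cc c0 hv; pose cl (t : R) : R := Num.max 0 (Num.min t 1).
have clu t : unit_itv (cl t).
  by rewrite /unit_itv/= /cl le_max lexx/= ge_max ler01/= ge_min lexx orbT.
have clE t : unit_itv t -> cl t = t.
  by move=> /andP[h0 h1]; rewrite /cl min_l// max_r.
have clL s t : `|cl s - cl t| <= `|s - t|.
  rewrite /cl; case: (leP s 1) => ?; case: (leP t 1) => ?;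
  repeat (match goal with |- context [Num.max ?a ?b] => case: (leP a b) => ? end);
  have := ler_norm (s - t); have := ler_norm (t - s); rewrite (distrC t s);
  by rewrite ler_norml => ? ?; apply/andP; split; lra.
have [||t ht htv] := @IVT R (fun t => dist x (c (cl t))) 0 1 v ler01; last 2 first.
- rewrite !clE /unit_itv/= ?lexx ?ler01// c0 dxx min_l// max_r//.
- by exists t => //; rewrite -htv clE.
apply: continuous_subspaceT => t; apply/cvgrPdist_lt => e e0.
have [del del0 hd] := cc _ (clu t) _ e0.
near=> s.
have st : `|s - t| < del by near: s; exists del => //= z /=; rewrite distrC.
have := hd _ (clu s) (le_lt_trans (clL s t) st).
have := dtri x (c (cl s)) (c (cl t)); have := dtri x (c (cl t)) (c (cl s)).
by rewrite (dsym (c (cl t)) (c (cl s))) ltr_norml; lra.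
Unshelve. all: end_near. Qed.

(* Reparametrise an almost shortest curve by the distance to its origin: splitting
   the curve at the two chosen times bounds the distance between them. *)
Lemma almost_geodesic x y e : 0 < e -> exists g : R -> X, [/\ g 0 = x, g 1 = y &
  forall s t, unit_itv s -> unit_itv t ->
    dist (g s) (g t) <= dist x y * `|s - t| + e].
Proof.
move=> e0; have [c [cc c0 c1 cl]] := almost_shortest x y e0.
(* The values of [tau] at 0 and 1 are imposed so that the ends of the new curve are x and y. *)
have /choice[tau htau] (s : R) : exists t, unit_itv s ->
    [/\ unit_itv t, dist x (c t) = s * dist x y, s = 0 -> t = 0 & s = 1 -> t = 1].
  have [->|s0] := eqVneq s 0.
    exists 0 => _; split; rewrite /unit_itv/= ?lexx ?ler01// ?c0 ?dxx ?mul0r//.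
  have [->|s1] := eqVneq s 1.
    by exists 1 => _; split; rewrite /unit_itv/= ?lexx ?ler01// ?c1 ?mul1r.
  have [us|] := pselect (unit_itv s); last by exists 0.
  have [|t ut ht] := @curve_ivt x c (s * dist x y) cc c0.
    rewrite c1 mulr_ge0//=; last by case/andP: us.
    by rewrite ler_piMl//; case/andP: us.
  by exists t => _; split => // /eqP; rewrite ?(negbTE s0) ?(negbTE s1).
have key s t : unit_itv s -> unit_itv t -> s <= t ->
    dist (c (tau s)) (c (tau t)) <= dist x y * (t - s) + e.
  move=> us ut st.
  have [us' ds _ _] := htau _ us; have [ut' dt _ _] := htau _ ut.
  have [/andP[? ?] /andP[? ?]] := (us', ut').
  have := dtri x (c (tau s)) y; have := dtri x (c (tau t)) y.
  have h : 0 <= dist x y * (t - s) by rewrite mulr_ge0// subr_ge0.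
  (* With D the distance from x to y, the three pieces sum to at most D + e. In the natural order
     the outer ones are s D and at least (1 - t) D; in the reversed order t D and at least (1 - s)
     D, which is even better. *)
  rewrite ds dt; have [tt|/ltW tt] := lerP (tau s) (tau t).
  - have := le_trans (@curve_length_ge3 c (tau s) (tau t) _ tt _) cl.
    by rewrite lee_fin c0 c1 ds => /(_ _ _)H; have := H _ _; nra.
  - have := le_trans (@curve_length_ge3 c (tau t) (tau s) _ tt _) cl.
    rewrite lee_fin c0 c1 dt (dsym (c (tau t)) (c (tau s))).
    by move=> /(_ _ _)H; have := H _ _; nra.
have u0 : unit_itv (0 : R) by rewrite /unit_itv/= lexx ler01.
have u1 : unit_itv (1 : R) by rewrite /unit_itv/= lexx ler01.
exists (c \o tau); split => /=.
- by have [_ _ -> //] := htau _ u0.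
- by have [_ _ _ ->] := htau _ u1.
- move=> s t us ut; have [st|ts] := lerP s t.
    by rewrite (le_trans (key _ _ us ut st)).
  by rewrite dsym (le_trans (key _ _ ut us (ltW ts))).
Qed.

(** A pointwise ultralimit of almost geodesics with errors 1/(n+1): the error disappears and the
    fixed endpoints are kept. *)
Lemma geodesic x y : exists g : R -> X, [/\ g 0 = x, g 1 = y &
  forall s t, unit_itv s -> unit_itv t ->
    dist (g s) (g t) <= dist x y * `|s - t|].
Proof.
have [U [UU Uinf]] := free_ultrafilter.
have /choice[g hg] (n : nat) : exists g : R -> X, [/\ g 0 = x, g 1 = y &
  forall s t, unit_itv s -> unit_itv t ->
    dist (g s) (g t) <= dist x y * `|s - t| + n.+1%:R^-1].
  by apply: almost_geodesic; rewrite invr_gt0 ltr0n.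
have /choice[f hf] (t : R) := ulimit_compact UU (fun n => g n t) Hm cX.
have lim t : (forall n, g n t = g 0%N t) -> f t = g 0%N t.
  move=> h; have [_ /(_ (f t) (g 0%N t))[eqd _] _ _] := Hm; apply: eqd.
  apply/eqP; rewrite eq_le d0 andbT; apply/ler_addgt0Pr => e e0.
  have [n] := filter_ex (hf t _ e0).
  by rewrite /= h dsym add0r => /ltW.
exists f; split.
- by rewrite lim => [|n]; have [-> _ _] := hg 0%N => //; have [-> _ _] := hg n.
- by rewrite lim => [|n]; have [_ -> _] := hg 0%N => //; have [_ -> _] := hg n.
move=> s t us ut; apply: (ulimit_dist_le UU dsym dtri (hf s) (hf t)) => e e0.
apply: filterS (ultra_small UU Uinf e0) => n /= hn.
by have [_ _ /(_ s t us ut) h] := hg n; rewrite (le_trans h)// lerD2l ltW.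
Qed.

End Geodesic.

(** * Closed walks and curves *)

Section ClosedWalk.
Context {R : realType} {X : choiceType}.
Variables (dist : X -> X -> R) (l : R).
Hypothesis dsym : forall x y, dist x y = dist y x.

Definition closed_walk (x : X) (w : seq X) :=
  path (fun a b => dist a b <= l) x w /\ last x w = x.

(* The number of idle steps of the walk [x :: w] at points of [B]. *)
Fixpoint dwell (B : set X) (x : X) (w : seq X) : nat :=
  if w is y :: w' then ((x == y) && (x \in B)) + dwell B y w' else 0.

Lemma dwell_cat B x p q : dwell B x (p ++ q) = (dwell B x p + dwell B (last x p) q)%N.
Proof. by elim: p x => //= y p IHp x; rewrite IHp addnA. Qed.

Lemma dwell_nseq B x J : dwell B x (nseq J x) = (J * (x \in B))%N.
Proof. by elim: J => //= J ->; rewrite eqxx mulSn. Qed.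

Lemma dwellE B x w : dwell B x w = (\sum_(i < size w)
  ((nth x (x :: w) i == nth x (x :: w) i.+1) && (nth x (x :: w) i \in B)))%N.
Proof.
suff h x0 y : dwell B y w = (\sum_(i < size w)
  ((nth x0 (y :: w) i == nth x0 (y :: w) i.+1) && (nth x0 (y :: w) i \in B)))%N.
  exact: h.
elim: w y => [|z w IHw] y /=; first by rewrite big_ord0.
by rewrite big_ord_recl /= IHw.
Qed.

Lemma walk_insert x w u v J : closed_walk x w -> u \in x :: w -> dist u v <= l ->
  0 <= l -> dist v v = 0 ->
  exists w', [/\ closed_walk x w', size w' = (size w + J.+2)%N,
    forall B, (dwell B x w + J * (v \in B) <= dwell B x w')%N,
    {subset x :: w <= x :: w'} & v \in w'].
Proof.
move=> [+ +] uw uv l0 vv; case/splitPl: uw => p1 p2 lp1.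
rewrite cat_path last_cat lp1 => /andP[pp1 pp2] lp2.
exists (p1 ++ (v :: nseq J v) ++ u :: p2); split.
- split; last by rewrite !last_cat /= lp2.
  have pJ : path (fun a b : X => dist a b <= l) v (nseq J v).
    by elim: J => //= J ->; rewrite vv l0.
  have lJ : last v (nseq J v) = v by elim: J {pJ} => //= J.
  by rewrite cat_path pp1 lp1 /= cat_path uv pJ lJ /= dsym uv pp2.
- by rewrite !size_cat /= size_nseq; lia.
- move=> B; rewrite !dwell_cat lp1 /= dwell_nseq.
  by lia.
- move=> y; rewrite !(inE, mem_cat) => /or3P[->//|->|->]; rewrite ?orbT//.
- by rewrite !(mem_cat, inE) eqxx !orbT.
Qed.

Hypotheses (l0 : 0 <= l) (dxx : forall x, dist x x = 0).

(** As long as a point of [P] is missed, connectivity applied to the set of visited points yields a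
    detour of two steps to a new point of [P]. *)
Lemma tour (P : seq X) x0 : x0 \in P ->
  (forall V : pred X, V x0 -> (exists2 v, v \in P & ~~ V v) ->
     exists u v, [/\ V u, v \in P, ~~ V v & dist u v <= l]) ->
  exists w, [/\ closed_walk x0 w, (size w <= 2 * size P)%N & {subset P <= x0 :: w}].
Proof.
move=> x0P conn; pose miss (w : seq X) := count (fun v => v \notin x0 :: w) P.
suff h m : forall w, closed_walk x0 w -> (miss w <= m)%N -> exists w',
    [/\ closed_walk x0 w', (size w' <= size w + 2 * m)%N & {subset P <= x0 :: w'}].
  by have [] := h (size P) [::] (conj isT erefl) (count_size _ _) => w [cw sw Pw]; exists w.
elim: m => [|m IHm] w cw mw.
  exists w; split => //; first exact: leq_addr.
  move=> v vP; apply: contraTT mw => vw.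
  by rewrite -ltnNge -has_count; apply/hasP; exists v.
have [Pw|/allPn[v0 v0P v0w]] := boolP (all (mem (x0 :: w)) P).
  exists w; split => //; first by rewrite leq_addr.
  exact/allP.
have [|u [v [uw vP vw uv]]] := conn (mem (x0 :: w)) (mem_head _ _).
  by exists v0.
have [w1 [cw1 sw1 _ sub vw1]] := walk_insert 0 cw uw uv l0 (dxx v).
have [|w' [cw' sw' Pw']] := IHm w1 cw1; last first.
  by exists w'; split => //; apply: leq_trans sw' _; rewrite sw1; lia.
rewrite -ltnS; apply: leq_trans mw; rewrite /miss.
(* The points missed by [w] split into those on [w1], among them [v], and the others, which include
   all points missed by [w1]. *)
rewrite -[X in (_ < X)%N]size_filter -(count_predC (mem (x0 :: w1))) !count_filter.
rewrite -add1n leq_add//.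
  rewrite -has_count; apply/hasP; exists v => //=.
  by rewrite vw andbT inE vw1 orbT.
apply: sub_count => z /= zw1; rewrite zw1 /=.
by apply: contra zw1; exact: sub.
Qed.

(** One detour per entry of [xs], with multiplicity, each leaving from a net point that the walk
    already visits. *)
Lemma walk_dwell (P xs : seq X) x0 w0 J : closed_walk x0 w0 ->
  {subset P <= x0 :: w0} -> (forall x, exists2 u, u \in P & dist u x <= l) ->
  exists w, [/\ closed_walk x0 w, size w = (size w0 + size xs * J.+2)%N &
    forall B, (J * count (fun x => x \in B) xs <= dwell B x0 w)%N].
Proof.
move=> cw0 Pw0 net.
suff [w [cw sw _ dw]] : exists w, [/\ closed_walk x0 w,
    size w = (size w0 + size xs * J.+2)%N, {subset P <= x0 :: w} &
    forall B, (J * count (fun x => x \in B) xs <= dwell B x0 w)%N].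
  by exists w.
elim: xs => [|x xs [w [cw sw Pw dw]]].
  by exists w0; split => //= [|B]; rewrite ?addn0 ?muln0.
have [u uP ux] := net x.
have [w1 [cw1 sw1 dw1 sub _]] := walk_insert J cw (Pw _ uP) ux l0 (dxx x).
exists w1; split => //=; first by rewrite sw1 sw; lia.
- by move=> z zP; apply: sub; apply: Pw.
- by move=> B; have := dw B; have := dw1 B; lia.
Qed.

End ClosedWalk.

(** * From closed walks to closed Lipschitz curves *)

Section WalkCurve.
Context {R : realType} {X : choiceType}.
Variables (dist : X -> X -> R) (l : R).
Hypotheses (Hm : is_metric dist) (cX : dcompact dist) (lX : length_space dist).

Let dxx x : dist x x = 0. Proof. by have [_ h _ _] := Hm; apply/h. Qed.
Let dsym x y : dist x y = dist y x. Proof. by have [_ _ h _] := Hm. Qed.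
Let dtri x y z : dist x z <= dist x y + dist y z.
Proof. by have [_ _ _ h] := Hm. Qed.

(** Each step of the walk is run along a geodesic during a time interval of length 1/size w. The
    geodesic of an idle step has length 0, so the curve rests there. *)
Lemma walk_curve x w : 0 <= l -> (0 < size w)%N -> closed_walk dist l x w ->
  exists g : R -> X, lip_closed_curve dist (l * (size w)%:R) g /\
   forall i t, nth x (x :: w) i = nth x (x :: w) i.+1 ->
     i%:R <= t * (size w)%:R < i.+1%:R -> g t = nth x (x :: w) i.
Proof.
move=> l0 w0 [pw lw]; pose M : R := (size w)%:R; pose z := nth x (x :: w).
have M0 : 0 < M by rewrite ltr0n.
have /choice[geo hgeo] (p : X * X) := geodesic Hm cX lX p.1 p.2.
have zM : z (size w) = x by rewrite /z nth_last.
have step i : dist (z i) (z i.+1) <= l.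
  have [iw|wi] := ltnP i (size w).
    by have /(pathP x)/(_ i iw) := pw; rewrite /z.
  (* Beyond its end the walk is continued by the default [x], which is also its last point; time 1
     falls into this range. *)
  rewrite [z i.+1]nth_default//; suff -> : z i = x by rewrite dxx.
  have [<-//|wi'] := eqVneq (size w) i.
  by rewrite /z nth_default//= ltn_neqAle wi'.
have steps i k : dist (z i) (z (i + k)%N) <= l * k%:R.
  elim: k => [|k IHk]; first by rewrite addn0 dxx mulr0.
  have := dtri (z i) (z (i + k)%N) (z (i + k.+1)%N).
  by have := step (i + k)%N; rewrite -addnS -natr1; lra.
pose I t : nat := Num.truncn (t * M).
pose g t := geo (z (I t), z (I t).+1) (t * M - (I t)%:R).
have It t : 0 <= t -> (I t)%:R <= t * M < (I t).+1%:R.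
  by move=> t0; rewrite truncn_itv// mulr_ge0// ltW.
have u0 : unit_itv (0 : R) by rewrite /unit_itv/= lexx ler01.
have u1 : unit_itv (1 : R) by rewrite /unit_itv/= lexx ler01.
have uI t : 0 <= t -> unit_itv (t * M - (I t)%:R).
  by move=> /It; rewrite -natr1 /unit_itv/= => h; apply/andP; split; lra.
have gI t i : i%:R <= t * M < i.+1%:R -> g t = geo (z i, z i.+1) (t * M - i%:R).
  by move=> /truncn_def h; rewrite /g /I h.
exists g; split; last first.
  move=> i t zi ti; rewrite (gI _ i)//= -/(z i).
  have [g0 _ gL] := hgeo (z i, z i.+1).
  have [_ /(_ (geo (z i, z i.+1) (t * M - i%:R)) (z i))[eqd _] _ _] := Hm.
  apply: eqd; rewrite -{2}[z i]g0.
  have uti : unit_itv (t * M - i%:R).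
    by move: ti; rewrite -natr1 /unit_itv/= => h; apply/andP; split; lra.
  have [dge0 _ _ _] := Hm.
  apply/eqP; rewrite eq_le dge0 andbT (le_trans (gL _ _ uti u0))//=.
  by rewrite /z -zi dxx mul0r.
split.
  rewrite (gI 0 0%N) ?mul0r ?lexx ?ltr01// (gI 1 (size w)); last first.
    by rewrite mul1r lexx ltr_nat ltnSn.
  rewrite mul1r !subrr; have [-> _ _] := hgeo (z 0%N, z 1%N).
  by have [-> _ _] := hgeo (z (size w), z (size w).+1); rewrite /= zM.
suff key s t : unit_itv s -> unit_itv t -> s <= t -> dist (g s) (g t) <= l * M * (t - s).
  move=> s t us ut; have [st|/ltW ts] := lerP s t.
    exact: key.
  by rewrite dsym; exact: key.
move=> /andP[s0 _] /andP[t0 _] st.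
have [us ut] := (uI _ s0, uI _ t0).
have [hs1 hs2] := andP (It _ s0); have [ht1 ht2] := andP (It _ t0).
have seg (r1 r2 : R) i : unit_itv r1 -> unit_itv r2 -> r1 <= r2 ->
    dist (geo (z i, z i.+1) r1) (geo (z i, z i.+1) r2) <= l * (r2 - r1).
  move=> ur1 ur2 r12; have [_ _ gL] := hgeo (z i, z i.+1).
  rewrite (le_trans (gL _ _ ur1 ur2))//= distrC ger0_norm ?subr_ge0//.
  by rewrite ler_wpM2r// subr_ge0.
have Ist : (I s <= I t)%N.
  by apply: le_truncn; rewrite ler_wpM2r// ltW.
have [E|nE] := eqVneq (I s) (I t).
  rewrite /g E (le_trans (seg _ _ _ _ _ _))//; last by rewrite -E; nra.
  - by rewrite -E.
  - by rewrite lerD2r ler_wpM2r// ltW.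
have {nE}Ilt : (I s < I t)%N by rewrite ltn_neqAle nE.
(* For times in different steps, the path goes through two vertices: the rest of the first step, the
   full steps in between, the beginning of the last one. *)
have [g0 g1 _] := hgeo (z (I s), z (I s).+1).
have [g0' g1' _] := hgeo (z (I t), z (I t).+1).
have h1 := seg _ _ (I s) us u1 (proj2 (andP us)).
have h3 := seg _ _ (I t) u0 ut (proj1 (andP ut)).
have h2 := steps (I s).+1 (I t - (I s).+1)%N.
rewrite subnKC// natrB// -natr1 in h2.
rewrite g1 /= in h1; rewrite g0' /= in h3.
have := dtri (g s) (z (I s).+1) (g t).
have := dtri (z (I s).+1) (z (I t)) (g t).
by move: h1 h2 h3; rewrite -/(g s) -/(g t); lra.
Qed.

End WalkCurve.

(** * Nets in Ahlfors regular spaces *)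

Section MetricMeasure.
Context {R : realType} {d0 : measure_display} {X : measurableType d0}.
Variable dist : X -> X -> R.
Hypotheses (Hm : is_metric dist) (cX : dcompact dist) (bX : borel_of_dist dist).

Let dge0 x y : 0 <= dist x y. Proof. by have [h _ _ _] := Hm. Qed.
Let dxx x : dist x x = 0. Proof. by have [_ h _ _] := Hm; apply/h. Qed.
Let dsym x y : dist x y = dist y x. Proof. by have [_ _ h _] := Hm. Qed.
Let dtri x y z : dist x z <= dist x y + dist y z.
Proof. by have [_ _ _ h] := Hm. Qed.

Lemma dopen_measurable (A : set X) : dopen dist A -> measurable A.
Proof. by move=> oA; rewrite bX; exact: sub_sigma_algebra. Qed.

Lemma dclosed_ball_measurable x r : measurable (dclosed_ball dist x r).
Proof.
rewrite -[X in measurable X]setCK; apply: measurableC; apply: dopen_measurable.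
move=> y /= /negP; rewrite -ltNge => ry; exists (dist x y - r); first by rewrite subr_gt0.
move=> z /=; rewrite /dopen_ball/= /dclosed_ball/= => yz; apply/negP; rewrite -ltNge.
by have := dtri x z y; rewrite (dsym z y); lra.
Qed.

(** The supremum [diam] is a true upper bound because finitely many balls of integer radius about
    one point cover the space. *)
Lemma dist_le_diam x y : dist x y <= diam dist.
Proof.
apply: ub_le_sup; last by exists x => //; exists y.
have [||J [/finite_seqP[s ->] sJ]] :=
    cX (I := nat) (U := fun n => dopen_ball dist point n%:R).
- move=> n u /= un; exists (n%:R - dist point u); first by rewrite subr_gt0.
  by move=> v; rewrite /dopen_ball/= => uv; have := dtri point u v; lra.
- move=> u _; exists (Num.truncn (dist point u)).+1 => //.
  by rewrite /dopen_ball/=; have /andP[] := truncn_itv (dge0 point u).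
pose M := \max_(n <- s) n.
have hM u : dist point u <= M%:R.
  have [n ns /ltW] := sJ u I; rewrite /dopen_ball/= => /le_trans; apply.
  by rewrite ler_nat /M; exact: leq_bigmax_seq.
exists (M%:R + M%:R) => _ [u _ [v _ <-]].
by have := dtri u point v; have := hM u; have := hM v; rewrite (dsym u point); lra.
Qed.

Definition separated (e : R) (s : seq X) := pairwise (fun x y => e < dist x y) s.

Section Net.
Variables (sigma : {finite_measure set X -> \bar R}) (d : R).
Hypotheses (dpos : 0 < d) (aX : ahlfors_regular dist sigma d).

(** Balls of radius r around points more than 2 r apart are disjoint, each has mass at least C1 r^d,
    and the total mass is finite. *)
Lemma packing : exists2 C : R, 0 < C & forall r s, 0 < r -> r <= diam dist ->
  separated (2 * r) s -> (size s)%:R * r `^ d <= C.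
Proof.
have [C1 [C2 [C10 [_ reg]]]] := aX.
have fX : sigma setT \is a fin_num by exact: fin_num_measure.
exists ((fine (sigma setT) + 1) / C1).
  by rewrite divr_gt0// ltr_wpDl ?fine_ge0.
move=> r s r0 rd seps; pose B (s : seq X) := [set y | exists2 x, x \in s & dclosed_ball dist x r y].
have BS x t : B (x :: t) = dclosed_ball dist x r `|` B t.
  apply/seteqP; split => y.
    by move=> [z]; rewrite inE => /predU1P[->|zt] yz; [left|right; exists z].
  by move=> [yx|[z zt yz]]; [exists x; rewrite ?mem_head|exists z; rewrite // inE zt orbT].
have mB t : measurable (B t).
  elim: t => [|x t IHt]; last first.
    by rewrite BS; apply: measurableU => //; exact: dclosed_ball_measurable.
  by rewrite (_ : B [::] = set0)// -subset0 => y [].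
have {}seps : (((size s)%:R * (C1 * r `^ d))%:E <= sigma (B s))%E.
  elim: s seps => [|x s IHs]; first by rewrite mul0r.
  rewrite /separated pairwise_cons => /andP[/allP xs /IHs {}IHs].
  rewrite BS measureU//; last 2 first.
  - exact: dclosed_ball_measurable.
  - rewrite -subset0 => y [/= yx [z zs]]; rewrite /dclosed_ball/= => yz.
    have := xs _ zs; have := dtri x y z; move: yx yz.
    by rewrite /dclosed_ball/= (dsym z y); lra.
  rewrite /= -add1n natrD mulrDl mul1r EFinD leeD//.
  by have [] := reg x r r0 rd.
have : (((size s)%:R * (C1 * r `^ d))%:E <= (fine (sigma setT))%:E)%E.
  by rewrite fineK// (le_trans seps)// le_measure ?inE.
rewrite lee_fin ler_pdivlMr// => h.
by rewrite -mulrA (mulrC (_ `^ _)) (le_trans h)// lerDl.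
Qed.

Definition net (e : R) (P : seq X) :=
  [/\ (0 < size P)%N, separated e P & forall x, exists2 u, u \in P & dist u x <= e].

(** A separated list of maximal length is a net, since an uncovered point could be added to it;
    [packing] bounds the lengths. *)
Lemma exists_net : exists2 C : R, 0 < C & forall e, 0 < e <= 1 ->
  exists2 P, net e P & (size P)%:R <= C * e `^ (- d).
Proof.
have [C0 C0p pack] := packing.
pose D := diam dist.
suff [C Cp bnd] : exists2 C : R, 0 < C & forall e s, 0 < e <= 1 -> separated e s ->
    (size s)%:R <= C * e `^ (- d).
  exists C => // e e01; have bnd' := bnd e ^~ e01.
  pose p n := `[< exists2 s, size s = n & separated e s >].
  have p1 : exists n, p n by exists 1%N; apply/asboolP; exists [:: point].
  have pub n : p n -> (n <= Num.truncn (C * e `^ (- d)))%N.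
    move=> /asboolP[s <- /bnd' h]; rewrite -ltnS -(ltr_nat R).
    by rewrite (le_lt_trans h)//; have /andP[] := truncn_itv (le_trans (ler0n _ _) h).
  have [n /asboolP[P sP sepP] nmax] := ex_maxnP p1 pub.
  exists P; last exact: bnd'.
  split => //.
    by rewrite sP; apply: nmax; apply/asboolP; exists [:: point].
  move=> x; apply: contrapT => nx.
  have : p n.+1.
    apply/asboolP; exists (x :: P); first by rewrite /= sP.
    rewrite /separated pairwise_cons; apply/andP; split=> //; apply/allP => u uP.
    by rewrite ltNge dsym; apply/negP => ux; apply: nx; exists u.
  by move/nmax; rewrite ltnn.
(* When the diameter is 0, regularity says nothing, but a separated list then has at most one
   entry. *)
have [D0|D0] := ltP 0 D; last first.
  exists 1 => // e s /andP[e0 e1] seps; rewrite mul1r powRN.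
  have s1 : (size s <= 1)%N.
    case: s seps => [|x [|y s]]//=; rewrite /separated/= => /andP[/andP[xy _] _].
    by have := dist_le_diam x y; rewrite -/D; lra.
  apply: (@le_trans _ _ 1); first by rewrite (ler_nat R _ 1).
  rewrite invf_ge1 ?powR_gt0//.
  suff : e `^ d <= 1 `^ d by rewrite powR1.
  by apply: ge0_ler_powR => //; rewrite ?nnegrE ?ler01 ?(ltW e0) ?(ltW dpos).
(* The radius c e stays below the diameter, as regularity demands, and 2 c e <= e, as [packing]
   demands. *)
pose c := Num.min (2^-1) D.
have c0 : 0 < c by rewrite lt_min D0 andbT invr_gt0.
exists (C0 / c `^ d); first by rewrite divr_gt0 ?powR_gt0.
move=> e s /andP[e0 e1] seps.
have ce : 0 < c * e by rewrite mulr_gt0.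
have cD : c * e <= D.
  by rewrite (le_trans (ler_piMr (ltW c0) e1))// /c ge_min lexx orbT.
have ce2 : 2 * (c * e) <= e.
  have : c <= 2^-1 by rewrite /c ge_min lexx.
  by move=> ?; nra.
have seps2 : separated (2 * (c * e)) s.
  by apply: sub_pairwise seps => x y; exact: le_lt_trans.
have := pack _ s ce cD seps2; rewrite (powRM _ (ltW c0) (ltW e0)) => h.
by rewrite powRN -mulrA -invfM ler_pdivlMr ?mulr_gt0 ?powR_gt0.
Qed.

End Net.

(** Follow a geodesic from [x0] to [v0] in steps of length at most e and stop at the first point
    within e of a net point outside [V]. The net point near the preceding stop lies in [V], and the
    three distances are at most e each. *)
Lemma net_connected (e : R) (P : seq X) (V : pred X) x0 v0 :
  length_space dist -> 0 < e -> net e P -> V x0 -> v0 \in P -> ~~ V v0 ->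
  exists u v, [/\ V u, v \in P, ~~ V v & dist u v <= 3 * e].
Proof.
move=> lX e0 [_ _ netP] Vx0 v0P nVv0.
have [g [g0 g1 gL]] := geodesic Hm cX lX x0 v0.
pose m := Num.truncn (dist x0 v0 / e).
have m0 : 0 < m.+1%:R :> R by rewrite ltr0n.
have Dm : dist x0 v0 / m.+1%:R <= e.
  rewrite ler_pdivrMr// mulrC -ler_pdivrMr//.
  by have /andP[_ /ltW] := truncn_itv (divr_ge0 (dge0 x0 v0) (ltW e0)).
pose far k := `[< exists2 v, v \in P & ~~ V v /\ dist (g (k%:R / m.+1%:R)) v <= e >].
have exf : exists k, far k.
  by exists m.+1; apply/asboolP; exists v0 => //; rewrite divff ?gt_eqF// g1 dxx ltW.
(* If the search stops at index 0, the geodesic is still at [x0], which itself serves as [u]. *)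
case: (ex_minnP exf) => -[|k] /asboolP[v vP [nVv gv]] kmin.
  exists x0, v; split => //; move: gv; rewrite mul0r g0; lra.
have km : (k < m.+1)%N.
  rewrite kmin//; apply/asboolP; exists v0 => //.
  by rewrite divff ?gt_eqF// g1 dxx ltW.
have [u uP ug] := netP (g (k%:R / m.+1%:R)).
have Vu : V u.
  apply: contraT => nVu; have : far k.
    by apply/asboolP; exists u => //; rewrite dsym.
  by move/kmin; rewrite ltnn.
exists u, v; split => //.
have uk (i : nat) : (i <= m.+1)%N -> unit_itv (i%:R / m.+1%:R : R).
  by move=> im; rewrite /unit_itv/= divr_ge0//= ler_pdivrMr// mul1r ler_nat.
have kk : k%:R / m.+1%:R - k.+1%:R / m.+1%:R = - m.+1%:R^-1 :> R.
  by rewrite -mulrBl -[k.+1%:R]natr1 opprD addrA subrr add0r mulN1r.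
have gk : dist (g (k%:R / m.+1%:R)) (g (k.+1%:R / m.+1%:R)) <= dist x0 v0 / m.+1%:R.
  apply: le_trans (gL _ _ (uk _ (ltnW km)) (uk _ km)) _.
  by rewrite kk normrN ger0_norm// invr_ge0 ltW.
move: (g (k%:R / _)) (g (k.+1%:R / _)) ug gv gk => a b ua bv ab.
have := le_trans ab Dm; have := dtri u a v; have := dtri a b v; clear -ua bv; lra.
Qed.

Lemma net_walk (e : R) (P xs : seq X) J : length_space dist -> 0 < e -> net e P ->
  exists x0 w, [/\ closed_walk dist (3 * e) x0 w, (0 < J -> 0 < size xs -> 0 < size w)%N,
    (size w <= 2 * size P + size xs * J.+2)%N &
    forall B, (J * count (fun x => x \in B) xs <= dwell B x0 w)%N].
Proof.
move=> lX e0 netP; have [P0 _ cov] := netP; pose x0 := nth point P 0.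
have l0 : 0 <= 3 * e by lra.
have [|V Vx0 [v vP nVv]|w0 [cw0 sw0 Pw0]] := @tour _ _ dist (3 * e) dsym l0 dxx P x0.
- exact: mem_nth.
- exact: net_connected netP Vx0 vP nVv.
have [|w [cw sw dw]] := walk_dwell dsym l0 dxx xs J cw0 Pw0.
  by move=> x; have [u uP ux] := cov x; exists u => //; lra.
exists x0, w; split => //.
  by rewrite sw => J0 xs0; rewrite addn_gt0 muln_gt0 xs0 orbT.
by rewrite sw leq_add2r.
Qed.

End MetricMeasure.

(** * Integrals of uniformly continuous functions *)

Section Functionals.
Context {R : realType} {d0 : measure_display} {X : measurableType d0}.
Variable dist : X -> X -> R.

Definition modulus (f : X -> R) (del e : R) :=
  forall x y, dist x y <= del -> `|f x - f y| <= e.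

Definition ucont (f : X -> R) :=
  forall e, 0 < e -> exists2 del, 0 < del & modulus f del e.

(** A finite partition into small pieces with a marked point in each. Disjointness concerns all
    indices and the first n pieces cover, so the later ones are empty. *)
Definition cells (del : R) (n : nat) (a : nat -> X) (A : nat -> set X) :=
  [/\ forall i, measurable (A i), trivIset setT A,
      forall i, (i < n)%N -> A i (a i),
      forall i x, (i < n)%N -> A i x -> dist (a i) x <= del &
      forall x, exists2 i, (i < n)%N & A i x].

(** The features of averaging shared by integrals against probability measures and by finite convex
    combinations of point evaluations. *)
Definition contractive (l : (X -> R) -> R) := l (fun=> 0) = 0 /\
  forall f f' e, ucont f -> ucont f' -> (forall x, `|f x - f' x| <= e) ->
    `|l f - l f'| <= e.

Section Weighted.
Context {d1 : measure_display} {T : measurableType d1}.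
Variables (m : {measure set T -> \bar R}) (D : set T) (phi : T -> X) (rho : T -> R).
Hypotheses (mD : measurable D) (mphi : measurable_fun D phi)
  (irho : m.-integrable D (EFin \o rho)) (rho0 : forall t, D t -> 0 <= rho t)
  (rho1 : \int[m]_(t in D) rho t = 1).

(** The integral of f against the image under [phi] of the measure with density [rho]; it covers
    plain means as well as measures on curves. *)
Definition weighted (f : X -> R) : R := \int[m]_(t in D) (f (phi t) * rho t).

Lemma weighted_integrable (f : X -> R) M : measurable_fun setT f -> (forall x, `|f x| <= M) ->
  m.-integrable D (EFin \o (fun t => f (phi t) * rho t)).
Proof.
move=> mf fM; apply: (@integrableMr _ _ _ m D mD (f \o phi) (EFin \o rho)) => //.
  exact: measurableT_comp.
exists M; split => [|y /ltW My t _]; first exact: num_real.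
exact: le_trans (fM _) My.
Qed.

Lemma weighted_sub (f f' : X -> R) M M' e : measurable_fun setT f -> measurable_fun setT f' ->
  (forall x, `|f x| <= M) -> (forall x, `|f' x| <= M') ->
  (forall x, `|f x - f' x| <= e) -> `|weighted f - weighted f'| <= e.
Proof.
move=> mf mf' fM fM' ff'.
have i1 := weighted_integrable mf fM; have i2 := weighted_integrable mf' fM'.
rewrite /weighted -RintegralB//.
have i3 : m.-integrable D (EFin \o (fun t => f (phi t) * rho t - f' (phi t) * rho t)).
  by apply: eq_integrable (integrableB mD i1 i2) => // t _.
rewrite (le_trans (le_normr_Rintegral mD i3))//.
have i4 : m.-integrable D (EFin \o (fun t => e * rho t)) by exact: (integrableZl mD e irho).
rewrite (@le_trans _ _ (\int[m]_(t in D) (e * rho t)))//.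
  apply: le_Rintegral => //; first exact: integrable_norm.
  move=> t Dt; rewrite -mulrBl normrM (ger0_norm (rho0 Dt)).
  by rewrite ler_wpM2r// rho0.
by rewrite RintegralZl// rho1 mulr1.
Qed.

(** The sum is the weighted integral of the step function with value [f (a i)] on [A i], which
    differs from f by at most e. *)
Lemma weighted_cells (f : X -> R) M e del n a A : measurable_fun setT f ->
  (forall x, `|f x| <= M) -> modulus f del e -> cells del n a A ->
  (forall x y, dist x y = dist y x) ->
  `|weighted f - \sum_(i < n) (\int[m]_(t in D `&` phi @^-1` A i) rho t) * f (a i)| <= e.
Proof.
move=> mf fM fmod [mA tA aA diamA covA] dsym.
pose s k x := \sum_(i < k) f (a i) * \1_(A i) x : R.
have ms k : measurable_fun setT (s k).
  apply: measurable_sum => i.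
  by apply: measurable_funM => //; exact: measurable_indic.
have sM k x : `|s k x| <= \sum_(i < k) M.
  rewrite (le_trans (ler_norm_sum _ _ _))// ler_sum// => i _.
  rewrite normrM (le_trans _ (fM (a i)))// ler_piMr//.
  by rewrite indicE; case: (_ \in _); rewrite ?normr1 ?normr0.
have sE x i : (i < n)%N -> A i x -> s n x = f (a i).
  move=> iN Aix; rewrite /s (bigD1 (Ordinal iN))//= indicE mem_set// mulr1.
  rewrite big1 ?addr0// => j /eqP ji; rewrite indicE memNset ?mulr0// => Ajx.
  by apply: ji; apply/val_inj => /=; apply: (tA) => //; exists x.
have -> : \sum_(i < n) (\int[m]_(t in D `&` phi @^-1` A i) rho t) * f (a i) =
    weighted (s n).
  elim: (n) => [|k IHk].
    rewrite big_ord0 /weighted /s.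
    under eq_Rintegral do rewrite big_ord0 mul0r.
    by rewrite Rintegral_cst// mul0r.
  have mDA : measurable (D `&` phi @^-1` A k) by exact: mphi.
  rewrite big_ord_recr /= IHk /weighted.
  under [RHS]eq_Rintegral do rewrite /s big_ord_recr /= -/(s k _) mulrDl.
  have i1 := weighted_integrable (ms k) (sM k).
  have m1 : measurable_fun setT (\1_(A k) : X -> R) by exact: measurable_indic.
  have i2 : m.-integrable D (EFin \o (fun t => \1_(A k) (phi t) * rho t)).
    apply: (@weighted_integrable _ 1 m1) => x.
    by rewrite indicE; case: (_ \in _); rewrite ?normr1 ?normr0.
  have i3 : m.-integrable D (EFin \o (fun t => f (a k) * \1_(A k) (phi t) * rho t)).
    by apply: eq_integrable (integrableZl mD (f (a k)) i2) => // t _ /=; rewrite -EFinM mulrA.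
  rewrite RintegralD//; congr (_ + _).
  under [RHS]eq_Rintegral do rewrite -mulrA.
  rewrite RintegralZl// mulrC; congr (_ * _).
  rewrite Rintegral_mkcondr; apply: eq_Rintegral => t _.
  rewrite /patch indicE; have [At|nAt] := pselect (A k (phi t)).
    by rewrite !mem_set// mul1r.
  by rewrite !memNset// mul0r.
apply: (weighted_sub mf (ms n) fM (sM n)) => x.
have [i iN Aix] := covA x; rewrite (sE x i iN Aix).
by apply: fmod; rewrite dsym diamA.
Qed.

End Weighted.

Hypotheses (Hm : is_metric dist) (cX : dcompact dist) (bX : borel_of_dist dist).
Let dxx x : dist x x = 0. Proof. by have [_ h _ _] := Hm; apply/h. Qed.
Let dsym x y : dist x y = dist y x. Proof. by have [_ _ h _] := Hm. Qed.
Let dtri x y z : dist x z <= dist x y + dist y z.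
Proof. by have [_ _ _ h] := Hm. Qed.

Lemma ucont_measurable f : ucont f -> measurable_fun setT f.
Proof.
move=> uf mT; apply: (measurability _ (RGenOInfty.measurableE R)) => //.
move=> _ [_ [c ->] <-]; rewrite setTI; apply: (dopen_measurable bX).
move=> x /=; rewrite in_itv/= andbT => cf.
have fc : 0 < (f x - c) / 2 by lra.
have [del del0 hdel] := uf _ fc.
exists del => // y /ltW/hdel; rewrite /= in_itv/= andbT ler_norml => /andP[_ h].
lra.
Qed.

Lemma ucont_bounded f : ucont f -> exists M, forall x, `|f x| <= M.
Proof.
move=> uf; have [del del0 hdel] := uf 1 ltr01.
have [||J [/finite_seqP[s ->] sJ]] := cX (U := fun x => dopen_ball dist x del).
- move=> x y /= xy; exists (del - dist x y); first by rewrite subr_gt0.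
  by move=> z; rewrite /dopen_ball /= => yz; have := dtri x y z; lra.
- by move=> x _; exists x => //=; rewrite /dopen_ball/= dxx.
exists (1 + \sum_(x <- s) `|f x|) => y.
have [x xs /ltW/hdel h] := sJ y I.
have : `|f x| <= \sum_(x <- s) `|f x|.
  by rewrite (big_rem x)//= lerDl sumr_ge0.
have := ler_normD (f x) (- (f x - f y)); rewrite normrN.
have -> : f x + - (f x - f y) = f y by lra.
lra.
Qed.

Lemma ucont_const c : ucont (fun=> c).
Proof. by move=> e e0; exists 1 => // x y _; rewrite subrr normr0 ltW. Qed.

Lemma weighted_contractive d1 (T : measurableType d1) (m : {measure set T -> \bar R})
    D phi rho : measurable D -> measurable_fun D phi ->
  m.-integrable D (EFin \o rho) -> (forall t, D t -> 0 <= rho t) ->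
  \int[m]_(t in D) rho t = 1 -> contractive (weighted m D phi rho).
Proof.
move=> mD mphi irho rho0 rho1; split.
  rewrite /weighted; under eq_Rintegral do rewrite mul0r.
  by rewrite Rintegral_cst// mul0r.
move=> f f' e uf uf' ff'.
have [M fM] := ucont_bounded uf; have [M' fM'] := ucont_bounded uf'.
by apply: weighted_sub ff' => //; first [exact: ucont_measurable|eassumption].
Qed.

End Functionals.

(** * Energies of the kernel *)

Section KernelForms.
Context {R : realType} {d0 : measure_display} {X : measurableType d0}.
Variables (dist : X -> X -> R) (K : X -> X -> R).
Hypotheses (Hm : is_metric dist) (cX : dcompact dist) (bX : borel_of_dist dist)
  (cK : continuous_kernel dist K).
Let dxx x : dist x x = 0. Proof. by have [_ h _ _] := Hm; apply/h. Qed.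
Let dsym x y : dist x y = dist y x. Proof. by have [_ _ h _] := Hm. Qed.
Let dtri x y z : dist x z <= dist x y + dist y z.
Proof. by have [_ _ _ h] := Hm. Qed.

Definition kernel_modulus (del e : R) := forall x x' y y',
  dist x x' <= del -> dist y y' <= del -> `|K x y - K x' y'| <= e.

(** Otherwise there are offending pairs at distances at most 1/(n+1); both members of a pair
    approach the same ultralimit, where [K] is continuous. *)
Lemma kernel_ucont e : 0 < e -> exists2 del, 0 < del & kernel_modulus del e.
Proof.
move=> e0; apply: contrapT => nK.
have /choice[q hq] (n : nat) : exists q : (X * X) * (X * X),
    [/\ dist q.1.1 q.1.2 <= n.+1%:R^-1, dist q.2.1 q.2.2 <= n.+1%:R^-1 &
        e < `|K q.1.1 q.2.1 - K q.1.2 q.2.2|].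
  apply: contrapT => nq; apply: nK; exists n.+1%:R^-1; first by rewrite invr_gt0 ltr0n.
  move=> x x' y y' xx' yy'; rewrite leNgt; apply/negP => h.
  by apply: nq; exists ((x, x'), (y, y')).
have [U [UU Uinf]] := free_ultrafilter.
have [x hx] := ulimit_compact UU (fun n => (q n).1.1) Hm cX.
have [y hy] := ulimit_compact UU (fun n => (q n).2.1) Hm cX.
have e2 : 0 < e / 2 by lra.
have [del del0 hdel] := cK x y e2.
have del2 : 0 < del / 2 by lra.
have [n [/= h1 [h2 h3]]] := filter_ex (filterI (hx _ del2)
  (filterI (hy _ del2) (ultra_small UU Uinf del2))).
have {}h3 : n.+1%:R^-1 < del / 2 := h3.
have [] := hq n; case: (q n) h1 h2 => [[a a'] [b b']] /= h1 h2 /le_lt_trans/(_ h3) aa' /le_lt_trans/(_ h3) bb'.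
apply/negP; rewrite -leNgt.
have ha : dist x a < del by rewrite dsym; lra.
have hb : dist y b < del by rewrite dsym; lra.
have ha' : dist x a' < del by have := dtri x a a'; rewrite (dsym x a); lra.
have hb' : dist y b' < del by have := dtri y b b'; rewrite (dsym y b); lra.
apply: le_trans (ler_distD (K x y) _ _) _.
by rewrite (distrC (K x y)) [leRHS]splitr lerD// ltW// hdel.
Qed.

Lemma kernel_bounded : exists2 M, 0 < M & forall x y, `|K x y| <= M.
Proof.
apply: contrapT => nK.
have /choice[q hq] (n : nat) : exists q : X * X, n.+1%:R < `|K q.1 q.2|.
  apply: contrapT => nq; apply: nK; exists n.+1%:R; first by rewrite ltr0n.
  move=> x y; rewrite leNgt; apply/negP => h.
  by apply: nq; exists (x, y).
have [U [UU Uinf]] := free_ultrafilter.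
have [x hx] := ulimit_compact UU (fun n => (q n).1) Hm cX.
have [y hy] := ulimit_compact UU (fun n => (q n).2) Hm cX.
have [del del0 hdel] := cK x y ltr01.
have [n [/= h1 [h2 h3]]] := filter_ex (filterI (hx _ del0)
  (filterI (hy _ del0) (Uinf (Num.truncn (`|K x y| + 1))))).
have := hq n; apply/negP; rewrite -leNgt.
have k0 : 0 <= `|K x y| + 1 by rewrite addr_ge0.
have /andP[_ h4] := truncn_itv k0.
have h5 : (Num.truncn (`|K x y| + 1)).+1%:R <= n.+1%:R :> R by rewrite ler_nat ltnS.
rewrite dsym in h1; rewrite dsym in h2.
have := hdel _ _ h1 h2; have := ler_normD (K x y) (K (q n).1 (q n).2 - K x y).
rewrite addrC subrK; lra.
Qed.

Definition mean (mu : probability X R) (f : X -> R) : R := \int[mu]_x f x.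

Lemma meanE mu : mean mu = weighted mu setT id (fun=> 1).
Proof.
by apply/funext => f; rewrite /mean /weighted; under [RHS]eq_Rintegral do rewrite mulr1.
Qed.

Lemma prob_integrable_cst (mu : probability X R) c :
  mu.-integrable setT (EFin \o (fun=> c)).
Proof. exact: finite_measure_integrable_cst. Qed.

Lemma prob_Rintegral1 (mu : probability X R) : \int[mu]_x 1 = 1.
Proof. by rewrite Rintegral_cst// mul1r [X in fine X](probability_setT mu). Qed.

Lemma mean_contractive mu : contractive dist (mean mu).
Proof.
rewrite meanE; apply: weighted_contractive => //.
- exact: prob_integrable_cst.
- exact: prob_Rintegral1.
Qed.

Lemma mean_cells mu f e del n a A : ucont dist f ->
  modulus dist f del e -> cells dist del n a A ->
  `|mean mu f - \sum_(i < n) fine (mu (A i)) * f (a i)| <= e.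
Proof.
move=> uf fmod cA; have [M fM] := ucont_bounded Hm cX uf.
have := weighted_cells measurableT (@measurable_id _ _ setT)
  (prob_integrable_cst mu 1) (fun _ _ => ler01) (prob_Rintegral1 mu)
  (ucont_measurable bX uf) fM fmod cA dsym.
rewrite -meanE; congr (`|_ - _| <= _); apply: eq_bigr => i _; congr (_ * _).
have [mA _ _ _ _] := cA.
by rewrite setTI preimage_id Rintegral_cst// mul1r.
Qed.

Lemma ucont_mean_integrable (mu : probability X R) f : ucont dist f ->
  mu.-integrable setT (EFin \o f).
Proof.
move=> uf; have [M fM] := ucont_bounded Hm cX uf.
have := weighted_integrable measurableT (@measurable_id _ _ setT)
  (prob_integrable_cst mu 1) (ucont_measurable bX uf) fM.
by apply: eq_integrable => // x _ /=; rewrite mulr1.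
Qed.

(** For means this is the double integral of [K]; general functionals put finite sums and integrals
    on the same footing. *)
Definition kform (l l' : (X -> R) -> R) : R := l (fun x => l' (K x)).

Lemma ucont_kernel x : ucont dist (K x).
Proof.
move=> e e0; have [del del0 hK] := kernel_ucont e0.
by exists del => // y y' yy'; apply: hK => //; rewrite dxx ltW.
Qed.

Lemma contractive_modulus l del e : contractive dist l -> 0 <= del ->
  kernel_modulus del e -> modulus dist (fun x => l (K x)) del e.
Proof.
move=> [_ cl] del0 hK x x' xx'; apply: cl; do ?exact: ucont_kernel.
by move=> y; apply: hK => //; rewrite dxx.
Qed.

Lemma ucont_potential l : contractive dist l -> ucont dist (fun x => l (K x)).
Proof.
move=> cl e e0; have [del del0 hK] := kernel_ucont e0.
by exists del => //; apply: contractive_modulus => //; exact: ltW.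
Qed.

Lemma kintE mu nu : kint K mu nu = kform (mean mu) (mean nu).
Proof.
rewrite /kint /kform /mean /Rintegral; congr fine; apply: eq_integral => x _.
by rewrite fineK// integrable_fin_num//; exact: ucont_mean_integrable (@ucont_kernel x).
Qed.

(** If [K] has modulus (del, e) and bound M, the test class contains every section [K x] and every
    potential of a contractive functional. *)
Definition close_on (del e M e' : R) (l l' : (X -> R) -> R) :=
  forall f, ucont dist f -> modulus dist f del e -> (forall x, `|f x| <= M) ->
    `|l f - l' f| <= e'.

(** The arguments are changed one at a time: first [l2] under the contractive [l1], then [l1],
    tested on the potential of [l2']. *)
Lemma kform_close del e M e' l1 l1' l2 l2' : 0 <= del ->
  kernel_modulus del e -> (forall x y, `|K x y| <= M) ->
  contractive dist l1 -> contractive dist l2 -> contractive dist l2' ->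
  close_on del e M e' l1 l1' -> close_on del e M e' l2 l2' ->
  `|kform l1 l2 - kform l1' l2'| <= 2 * e'.
Proof.
move=> del0 hK KM cl1 cl2 cl2' h1 h2.
have a1 : `|kform l1 l2 - kform l1 l2'| <= e'.
  apply: cl1.2; [exact: ucont_potential|exact: ucont_potential|move=> x].
  apply: h2; [exact: ucont_kernel| |exact: KM].
  by move=> y y' yy'; apply: hK => //; rewrite dxx.
have a2 : `|kform l1 l2' - kform l1' l2'| <= e'.
  apply: h1; [exact: ucont_potential|exact: contractive_modulus|move=> x].
  have [l0 cl] := cl2'; have := cl (K x) (fun=> 0) M (@ucont_kernel x) (@ucont_const _ _ _ _ 0).
  by rewrite l0 subr0; apply => y; rewrite subr0.
by rewrite (le_trans (ler_distD (kform l1 l2') _ _))//; lra.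
Qed.

Definition dsum (n : nat) (a : nat -> X) (w : nat -> R) (f : X -> R) : R :=
  \sum_(i < n) w i * f (a i).

Lemma dsum_contractive n a w : (forall i, (i < n)%N -> 0 <= w i) ->
  \sum_(i < n) w i = 1 -> contractive dist (dsum n a w).
Proof.
move=> w0 w1; split; first by rewrite /dsum big1// => i _; rewrite mulr0.
move=> f f' e _ _ ff'; rewrite /dsum -sumrB.
under eq_bigr do rewrite -mulrBr.
rewrite (le_trans (ler_norm_sum _ _ _))// -(mul1r e) -w1 mulr_suml ler_sum// => i _.
by rewrite normrM ger0_norm ?w0// ler_wpM2l ?w0.
Qed.

Lemma cells_sum1 (mu : probability X R) del n a A : cells dist del n a A ->
  \sum_(i < n) fine (mu (A i)) = 1.
Proof.
move=> [mA tA _ _ cov].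
have : mu (\big[setU/set0]_(i < n) A i) = 1%E.
  rewrite (_ : \big[_/_]_(i < n) _ = setT) ?probability_setT//.
  by apply/seteqP; split => // x _; have [i iN Ax] := cov x; rewrite -bigcup_mkord; exists i.
rewrite measure_bigsetU// => h.
apply: EFin_inj; rewrite -h -sumEFin; apply: eq_bigr => i _.
by rewrite fineK// fin_num_measure.
Qed.

Lemma kint_cells e del n a A mu nu : 0 < del -> kernel_modulus del e ->
  cells dist del n a A ->
  `|kint K mu nu - \sum_(i < n) \sum_(j < n)
      fine (mu (A i)) * fine (nu (A j)) * K (a i) (a j)| <= 2 * e.
Proof.
move=> del0 hK cA; have [M M0 KM] := kernel_bounded.
rewrite kintE.
have -> : \sum_(i < n) \sum_(j < n) fine (mu (A i)) * fine (nu (A j)) * K (a i) (a j) =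
    kform (dsum n a (fun i => fine (mu (A i)))) (dsum n a (fun i => fine (nu (A i)))).
  rewrite /kform /dsum; apply: eq_bigr => i _; rewrite mulr_sumr.
  by apply: eq_bigr => j _; rewrite mulrA.
apply: (kform_close (ltW del0) hK KM) => //; try exact: mean_contractive.
- by apply: dsum_contractive => [i _|]; rewrite ?fine_ge0// (cells_sum1 _ cA).
- by move=> f uf fmod _; exact: (mean_cells _ uf fmod cA).
- by move=> f uf fmod _; exact: (mean_cells _ uf fmod cA).
Qed.

End KernelForms.

(** * Partitions into small cells *)

Section Cells.
Context {R : realType} {d0 : measure_display} {X : measurableType d0}.
Variable dist : X -> X -> R.
Hypotheses (Hm : is_metric dist) (bX : borel_of_dist dist).

(** Each ball around a net point is stripped of the earlier balls; its centre survives because net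
    points are more than [del] apart. *)
Lemma net_cells (del : R) P : 0 <= del -> net dist del P ->
  exists A, cells dist del (size P) (nth point P) A.
Proof.
move=> del0 [P0 sepP cov].
pose F i := if (i < size P)%N then dclosed_ball dist (nth point P i) del else set0.
have FE i : (i < size P)%N -> F i = dclosed_ball dist (nth point P i) del.
  by move=> iP; rewrite /F iP.
have mF i : measurable (F i).
  by rewrite /F; case: ifP => // _; exact: dclosed_ball_measurable.
exists (seqDU F); split.
- by move=> i; apply: seqDU_measurable; exact: mF.
- by apply: trivIset_seqDU.
- move=> i iP; rewrite /seqDU; split.
    by rewrite FE// /dclosed_ball/=; have [_ /(_ (nth point P i) (nth point P i))[_ ->]] := Hm.
  rewrite -bigcup_mkord => -[j /= ji]; rewrite FE ?(ltn_trans ji)// /dclosed_ball/=.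
  apply/negP; rewrite -ltNge.
  move: sepP => /(pairwiseP point)/(_ j i) h.
  by apply: h => //; rewrite inE (ltn_trans ji iP).
- by move=> i x iP Ax; have := subset_seqDU Ax; rewrite FE.
- move=> x; have [u uP ux] := cov x.
  have : (\bigcup_k F k) x.
    exists (index u P) => //; rewrite FE ?index_mem// nth_index//.
  rewrite seqDU_bigcup_eq => -[i _ Fi]; exists i => //.
  by have := subset_seqDU Fi; rewrite /F; case: ifP.
Qed.

End Cells.

(** * Measures carried by curves *)

Section UnitInterval.
Context {R : realType}.
Local Notation lambda := (@lebesgue_measure R).

Lemma unit_itvE : unit_itv = `[0, 1]%classic :> set R.
Proof. by apply/seteqP; split => t; rewrite /unit_itv/= in_itv. Qed.

Lemma measurable_unit_itv : measurable (unit_itv : set (measurableTypeR R)).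
Proof. by rewrite unit_itvE. Qed.

Lemma lebesgue_unit_itv : lambda unit_itv = 1%E.
Proof. by rewrite unit_itvE lebesgue_measure_itv/= lte_fin ltr01 sube0. Qed.

Lemma unit_integrable (f : R -> R) M :
  measurable_fun (unit_itv : set (measurableTypeR R)) f ->
  (forall t, unit_itv t -> `|f t| <= M) -> lambda.-integrable unit_itv (EFin \o f).
Proof.
have finU : (lambda unit_itv < +oo)%E by rewrite lebesgue_unit_itv ltry.
move=> mf fM; apply: measurable_bounded_integrable => //.
- exact: measurable_unit_itv.
- exists M; split => [|y /ltW My t ut]; first exact: num_real.
  exact: le_trans (fM _ ut) My.
Qed.

Lemma unit_Rintegral_cst (c : R) : \int[lambda]_(t in unit_itv) c = c.
Proof.
transitivity (c * fine (lambda unit_itv)); last by rewrite lebesgue_unit_itv mulr1.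
exact: (@Rintegral_cst _ _ R lebesgue_measure _ measurable_unit_itv).
Qed.

Lemma rel_open_measurable (E : set (measurableTypeR R)) :
  (forall t, E t -> unit_itv t /\ exists2 r, 0 < r &
     forall s, unit_itv s -> `|t - s| < r -> E s) -> measurable E.
Proof.
move=> hE.
pose Q := [set p : R * R | E p.1 /\ 0 < p.2 /\
  forall s, unit_itv s -> `|p.1 - s| < p.2 -> E s].
have -> : E = unit_itv `&` \bigcup_(p in Q) ball p.1 p.2.
  apply/seteqP; split => [t Et|s [us [p [_ [_ hp]] ps]]]; last exact: hp.
  have [ut [r r0 hr]] := hE t Et; split => //.
  by exists (t, r) => //; exact: ballxx.
apply: measurableI; first exact: measurable_unit_itv.
apply: open_measurable; apply: bigcup_open => p [_ [p0 _]].
exact: ball_open.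
Qed.

Lemma unit_lipschitz_measurable (f : R -> R) L : 0 <= L ->
  (forall s t, unit_itv s -> unit_itv t -> `|f s - f t| <= L * `|s - t|) ->
  measurable_fun (unit_itv : set (measurableTypeR R)) f.
Proof.
move=> L0 fL mT; apply: (measurability _ (RGenOInfty.measurableE R)) => //.
move=> _ [_ [c ->] <-]; apply: rel_open_measurable => t [ut /=].
rewrite in_itv/= andbT => cf; split => //.
have L1 : 0 < L + 1 by rewrite ltr_wpDl.
(* Dividing by L + 1 rather than L covers the case L = 0. *)
exists ((f t - c) / (L + 1)); first by rewrite divr_gt0// subr_gt0.
move=> s us ts; split => //=; rewrite in_itv/= andbT.
have := fL _ _ ut us; rewrite ler_norml => /andP[_ h].
move: ts; rewrite ltr_pdivlMr// => ts.
have := normr_ge0 (t - s); nra.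
Qed.

End UnitInterval.

(** * Laws of curves with Lipschitz densities *)

Section CurveLaw.
Context {R : realType} {d0 : measure_display} {X : measurableType d0}.
Variable dist : X -> X -> R.
Hypotheses (Hm : is_metric dist) (cX : dcompact dist) (bX : borel_of_dist dist).
Local Notation lambda := (@lebesgue_measure R).
Let dsym x y : dist x y = dist y x. Proof. by have [_ _ h _] := Hm. Qed.

Lemma lip_curve_measurable L g : 0 <= L -> lip_closed_curve dist L g ->
  measurable_fun (unit_itv : set (measurableTypeR R)) g.
Proof.
move=> L0 [_ gL] mT; apply: (measurability _ bX) => //.
move=> _ [A oA <-]; apply: rel_open_measurable => t [ut At]; split => //.
have [r r0 hr] := oA _ At.
have L1 : 0 < L + 1 by rewrite ltr_wpDl.
exists (r / (L + 1)); first by rewrite divr_gt0.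
move=> s us ts; split => //; apply: hr; rewrite /dopen_ball/=.
apply: le_lt_trans (gL _ _ ut us) _.
move: ts; rewrite ltr_pdivlMr// => ts.
by have := normr_ge0 (t - s); nra.
Qed.

(** Nonnegativity is pointwise here; [lipschitz_density_ge0] derives it from the nonnegative
    integrals in [Acurve]. *)
Definition curve_density (L : R) (rho : R -> R) :=
  [/\ forall s t, unit_itv s -> unit_itv t -> `|rho s - rho t| <= L * `|s - t|,
      forall t, unit_itv t -> 0 <= rho t &
      \int[lambda]_(t in unit_itv) rho t = 1].

Definition curve_law (g : R -> X) (rho : R -> R) (nu : probability X R) :=
  forall B, measurable B ->
    nu B = (\int[lambda]_(t in unit_itv `&` g @^-1` B) (rho t)%:E)%E.

(** On [0,1] the density is at least [rho t - L], and its integral is 1. The bound is uniform over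
    densities, which gives compactness of their values. *)
Lemma density_bound L rho t : 0 <= L -> curve_density L rho -> unit_itv t ->
  `|rho t| <= 1 + L.
Proof.
move=> L0 [rL rho0 rho1] ut; rewrite ger0_norm ?rho0//.
have mrho := unit_lipschitz_measurable L0 rL.
have bnd s : unit_itv s -> `|rho s| <= `|rho t| + L.
  move=> us; have := ler_normD (rho t) (rho s - rho t); rewrite addrC subrK.
  have := rL _ _ us ut; have : L * `|s - t| <= L.
    rewrite ler_piMr// ler_norml; case/andP: us => ? ?; case/andP: ut => ? ?.
    by apply/andP; split; lra.
  by lra.
suff : rho t - L <= 1 by lra.
rewrite -rho1 -(unit_Rintegral_cst (rho t - L)); apply: le_Rintegral.
- exact: measurable_unit_itv.
- by apply: (@unit_integrable _ _ `|rho t - L|).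
- exact: unit_integrable bnd.
move=> s us; have := rL _ _ ut us; rewrite ler_norml => /andP[_].
have : L * `|t - s| <= L.
  rewrite ler_piMr// ler_norml; case/andP: us => ? ?; case/andP: ut => ? ?.
  by apply/andP; split; lra.
by lra.
Qed.

Lemma density_integrable L rho : 0 <= L -> curve_density L rho ->
  lambda.-integrable unit_itv (EFin \o rho).
Proof.
move=> L0 cr; have [rL _ _] := cr.
by apply: (unit_integrable (unit_lipschitz_measurable L0 rL)) => t; exact: (density_bound L0 cr).
Qed.

Lemma curve_law_exists L g rho : 0 <= L -> lip_closed_curve dist L g ->
  curve_density L rho -> exists nu, curve_law g rho nu.
Proof.
move=> L0 gL cr; have [_ rho0 rho1] := cr.
have irho := density_integrable L0 cr.
have mg := lip_curve_measurable L0 gL.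
pose nu B := (\int[lambda]_(t in unit_itv `&` g @^-1` B) (rho t)%:E)%E.
have nu0 : nu set0 = 0%E by rewrite /nu preimage_set0 setI0 integral_set0.
have nuge0 B : (0 <= nu B)%E.
  by apply: integral_ge0 => t [ut _]; rewrite lee_fin rho0.
have nuD : semi_sigma_additive nu.
  move=> F mF tF mUF.
  have mgF k : measurable (unit_itv `&` g @^-1` F k).
    by apply: mg => //; exact: measurable_unit_itv.
  rewrite /nu preimage_bigcup setI_bigcupr ge0_integral_bigcup//; last first.
  - by move=> i j _ _ [t [[_ Fi] [_ Fj]]]; apply: tF => //; exists (g t).
  - by move=> t [k _ [ut _]]; rewrite lee_fin rho0.
  - apply: (@measurable_funS _ _ _ _ unit_itv); first exact: measurable_unit_itv.
      by move=> t [k _ []].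
    exact: (measurable_int lambda).
  apply: is_cvg_ereal_nneg_natsum_cond => n _ _.
  by apply: integral_ge0 => t [ut _]; rewrite lee_fin rho0.
have nu1 : nu setT = 1%E.
  rewrite /nu preimage_setT setIT -[LHS]fineK.
    by congr (_%:E); exact: rho1.
  by apply: (integrable_fin_num _ irho); exact: measurable_unit_itv.
pose m := isMeasure.Build _ _ _ nu nu0 nuge0 nuD.
pose mnu : {measure set X -> \bar R} := HB.pack nu m.
pose pnu : probability X R := HB.pack nu m (Measure_isProbability.Build _ _ _ mnu nu1).
by exists pnu => B mB.
Qed.

Hypothesis cellsX : forall del, 0 < del -> exists n a A, cells dist del n a A.

(** Change of variables: both sides are within e/2 of the same sum over cells, because [curve_law]
    gives the mass of each cell. *)
Lemma curve_mean L g rho nu f : 0 <= L -> lip_closed_curve dist L g ->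
  curve_density L rho -> curve_law g rho nu -> ucont dist f ->
  mean nu f = weighted lambda unit_itv g rho f.
Proof.
move=> L0 gL cr law uf; have [_ rho0 rho1] := cr.
apply/eqP; rewrite -subr_eq0 -normr_eq0 eq_le normr_ge0 andbT.
apply/ler_addgt0Pr => e e0; rewrite add0r.
have e2 : 0 < e / 2 by lra.
have [del del0 fmod] := uf _ e2; have [n [a [A cA]]] := cellsX del0.
have [M fM] := ucont_bounded Hm cX uf; have [mA _ _ _ _] := cA.
have := mean_cells Hm cX bX nu uf fmod cA.
have := weighted_cells measurable_unit_itv (lip_curve_measurable L0 gL)
  (density_integrable L0 cr) rho0 rho1 (ucont_measurable bX uf) fM fmod cA dsym.
under [X in _ -> `|_ - X| <= _ -> _]eq_bigr => i _ do rewrite (law _ (mA i)).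
move: (\sum_(i < n) _) => S h1 h2; rewrite (le_trans (ler_distD S _ _))//.
by rewrite (distrC S); lra.
Qed.

Lemma weighted_close L g g' rho rho' del e M eta : 0 <= L -> 0 <= e -> 0 <= M ->
  lip_closed_curve dist L g -> lip_closed_curve dist L g' ->
  curve_density L rho -> curve_density L rho' ->
  (forall t, unit_itv t -> dist (g t) (g' t) <= del) ->
  (forall t, unit_itv t -> `|rho t - rho' t| <= eta) ->
  close_on dist del e M (e + M * eta) (weighted lambda unit_itv g rho)
    (weighted lambda unit_itv g' rho').
Proof.
move=> L0 e0 M0 gL gL' cr cr' gg' rr' f uf fmod fM.
have [_ rho0 rho1] := cr.
have mf := ucont_measurable bX uf.
have i1 := weighted_integrable measurable_unit_itv (lip_curve_measurable L0 gL)
  (density_integrable L0 cr) mf fM.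
have i2 := weighted_integrable measurable_unit_itv (lip_curve_measurable L0 gL')
  (density_integrable L0 cr') mf fM.
have mU := @measurable_unit_itv R.
rewrite /weighted -RintegralB//.
have i3 : lambda.-integrable unit_itv
    (EFin \o (fun t => f (g t) * rho t - f (g' t) * rho' t)).
  by apply: eq_integrable (integrableB mU i1 i2) => // t _.
rewrite (le_trans (le_normr_Rintegral mU i3))//.
have i4 : lambda.-integrable unit_itv (EFin \o (fun t => e * rho t)).
  exact: (integrableZl mU e (density_integrable L0 cr)).
have i5 : lambda.-integrable unit_itv (EFin \o (fun=> M * eta)).
  by apply: (@unit_integrable _ _ `|M * eta|).
have -> : e + M * eta = \int[lambda]_(t in unit_itv) (e * rho t + M * eta).
  rewrite RintegralD// RintegralZl//; last exact: density_integrable cr.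
  by rewrite rho1 mulr1 unit_Rintegral_cst.
apply: le_Rintegral => //.
- exact: integrable_norm.
- by apply: eq_integrable (integrableD mU i4 i5) => // t _.
move=> t ut.
have -> : f (g t) * rho t - f (g' t) * rho' t =
  (f (g t) - f (g' t)) * rho t + f (g' t) * (rho t - rho' t) by ring.
rewrite (le_trans (ler_normD _ _))// !normrM (ger0_norm (rho0 _ ut)) lerD//.
  by rewrite ler_wpM2r ?rho0// fmod// gg'.
by rewrite ler_pM// rr'.
Qed.

End CurveLaw.

(** * The two classes of curve measures, and the law of a walk *)

Section CurveClasses.
Context {R : realType} {d0 : measure_display} {X : measurableType d0}.
Variable dist : X -> X -> R.
Hypotheses (Hm : is_metric dist) (cX : dcompact dist) (bX : borel_of_dist dist).
Local Notation lambda := (@lebesgue_measure R).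

(* [Acurve] is the case of no constraint [S] on the density, [Lcurve] the case of density 1. *)
Definition curve_class (S : (R -> R) -> Prop) (L : R) (nu : probability X R) :=
  exists g rho, [/\ lip_closed_curve dist L g, curve_density L rho, S rho &
    curve_law g rho nu].

Lemma unit_lipschitz_integrable (f : R -> R) L : 0 <= L ->
  (forall s t, unit_itv s -> unit_itv t -> `|f s - f t| <= L * `|s - t|) ->
  lambda.-integrable unit_itv (EFin \o f).
Proof.
move=> L0 fL; apply: (unit_integrable (unit_lipschitz_measurable L0 fL)
  (M := `|f 0| + L)) => t ut.
have u0 : unit_itv (0 : R) by rewrite /unit_itv/= lexx ler01.
have := ler_normD (f 0) (f t - f 0); rewrite addrC subrK.
have := fL _ _ ut u0; rewrite subr0; have : L * `|t| <= L.
  by rewrite ler_piMr// ger0_norm; case/andP: ut.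
by lra.
Qed.

(** If [rho t] were -2 c < 0, then rho <= -c on an interval of length r around t, and the integral
    over it would be negative. *)
Lemma lipschitz_density_ge0 (rho : R -> R) L : 0 <= L ->
  (forall s t, unit_itv s -> unit_itv t -> `|rho s - rho t| <= L * `|s - t|) ->
  (forall B : set R, measurable B -> B `<=` unit_itv ->
    (0 <= \int[lambda]_(t in B) (rho t)%:E)%E) ->
  forall t, unit_itv t -> 0 <= rho t.
Proof.
move=> L0 rL rpos t ut; rewrite leNgt; apply/negP => rt0.
pose c := - rho t / 2; have c0 : 0 < c by rewrite /c; lra.
pose r := Num.min (c / (L + 1)) (2^-1).
have L1 : 0 < L + 1 by lra.
have r0 : 0 < r by rewrite lt_min divr_gt0//= invr_gt0.
have r2 : r <= 2^-1 by rewrite /r ge_min lexx orbT.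
have Lr : L * r <= c.
  have : r <= c / (L + 1) by rewrite /r ge_min lexx.
  by rewrite ler_pdivlMr// => h; nra.
(* Since r <= 1/2, the interval fits into [0,1] to the right or to the left of t. *)
have [a [ua uar ta]] : exists a, [/\ 0 <= a, a + r <= 1 & a <= t <= a + r].
  case/andP: ut => ? ?.
  by have [ht|ht] := lerP t (2^-1); [exists t|exists (t - r)]; split; try lra;
    apply/andP; split; lra.
pose B : set (measurableTypeR R) := `[a, a + r]%classic.
have mB : measurable B by exact: measurable_itv.
have BU : B `<=` unit_itv.
  by move=> s; rewrite /B/= in_itv/= => /andP[? ?]; apply/andP; split; lra.
have iB := integrableS (measurable_unit_itv) mB BU (unit_lipschitz_integrable L0 rL).
have iC : lambda.-integrable B (EFin \o (fun=> - c)).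
  apply: (integrableS measurable_unit_itv mB BU).
  by apply: (@unit_integrable _ _ `|- c|).
have : \int[lambda]_(s in B) rho s <= \int[lambda]_(s in B) (- c).
  apply: le_Rintegral => // s Bs.
  have us := BU _ Bs; have := rL _ _ us ut; rewrite ler_norml => /andP[_].
  have : L * `|s - t| <= c.
    apply: le_trans Lr; rewrite ler_wpM2l// ler_norml.
    move: Bs; rewrite /B/= in_itv/= => /andP[? ?]; case/andP: ta => ? ?.
    by apply/andP; split; lra.
  by rewrite /c; lra.
have rB : fine (lambda B) = r.
  by rewrite /B lebesgue_measure_itv/= lte_fin ltrDl r0/=; lra.
have -> : \int[lambda]_(s in B) (- c) = - c * r.
  transitivity (- c * fine (lambda B)); last by rewrite rB.
  exact: (@Rintegral_cst _ _ R lebesgue_measure _ mB).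
have rho_ge0 : 0 <= \int[lambda]_(s in B) rho s.
  by apply: fine_ge0; exact: rpos mB BU.
by nra.
Qed.

Lemma AcurveP L nu : 0 <= L -> Acurve dist L nu <-> curve_class (fun=> True) L nu.
Proof.
move=> L0; split.
  move=> [g [rho [gL [rL [rpos [r1 law]]]]]]; exists g, rho; split => //.
  split => //; first exact: (lipschitz_density_ge0 L0 rL rpos).
  by rewrite /Rintegral r1.
move=> [g [rho [gL cr _ law]]]; have [rL rho0 rho1] := cr.
exists g, rho; split => //; split => //; split.
  by move=> B mB BU; apply: integral_ge0 => t Bt; rewrite lee_fin rho0//; exact: BU.
split => //; rewrite -[LHS]fineK; first by congr (_%:E); exact: rho1.
by apply: (integrable_fin_num _ (density_integrable L0 cr)); exact: measurable_unit_itv.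
Qed.

Lemma unit_density L : 0 <= L -> curve_density L (fun=> 1 : R).
Proof.
move=> L0; split => //; last exact: unit_Rintegral_cst.
by move=> s t _ _; rewrite subrr normr0 mulr_ge0.
Qed.

Lemma LcurveP L nu : 0 <= L ->
  Lcurve dist L nu <-> curve_class (fun rho => forall t, unit_itv t -> rho t = 1) L nu.
Proof.
move=> L0.
have lawE g rho B : (forall t, unit_itv t -> rho t = 1) -> lip_closed_curve dist L g ->
    measurable B ->
    (\int[lambda]_(t in unit_itv `&` g @^-1` B) (rho t)%:E)%E =
    lambda (unit_itv `&` g @^-1` B).
  move=> rho1 gL mB.
  have mU : measurable (unit_itv `&` g @^-1` B : set (measurableTypeR R)).
    by apply: (lip_curve_measurable bX L0 gL) => //; exact: measurable_unit_itv.
  rewrite (eq_integral (cst 1%E)); last by move=> t; rewrite inE => -[/rho1 -> _].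
  by rewrite integral_cst// mul1e.
split.
  move=> [g [gL law]]; exists g, (fun=> 1); split => //; first exact: unit_density.
  by move=> B mB; rewrite law//; apply/esym; exact: lawE.
move=> [g [rho [gL _ rho1 law]]]; exists g; split => // B mB.
by rewrite law//; exact: lawE.
Qed.

(** Each idle step at a point of [B] holds the curve in [B] for a time 1/size w, and these time
    intervals are disjoint. *)
Lemma walk_law l L x w : length_space dist -> 0 <= l -> (0 < size w)%N ->
  closed_walk dist l x w -> l * (size w)%:R <= L ->
  exists2 nu, Lcurve dist L nu & forall B, measurable B ->
    (dwell B x w)%:R / (size w)%:R <= fine (nu B).
Proof.
move=> lX l0 w0 cw lL; have [g [[g01 gl] gz]] := walk_curve Hm cX lX l0 w0 cw.
pose M : R := (size w)%:R; have M0 : 0 < M by rewrite ltr0n.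
have L0 : 0 <= L by rewrite (le_trans _ lL)// mulr_ge0// ltW.
have gL : lip_closed_curve dist L g.
  by split => // s t us ut; rewrite (le_trans (gl _ _ us ut))// ler_wpM2r.
have [nu law] := curve_law_exists bX L0 gL (unit_density L0).
have [_ +] := LcurveP nu L0.
move=> /(_ (ex_intro _ g (ex_intro _ (fun=> 1) (And4 gL (unit_density L0) (fun _ _ => erefl) law)))).
move=> nuL; exists nu => // B mB.
have nuB : nu B = lambda (unit_itv `&` g @^-1` B).
  rewrite law//; apply: eq_trans (_ : (\int[lambda]_(t in unit_itv `&` g @^-1` B) 1)%E = _) => //.
  rewrite integral_cst ?mul1e//.
  by apply: (lip_curve_measurable bX L0 gL) => //; exact: measurable_unit_itv.
pose good i := (nth x (x :: w) i == nth x (x :: w) i.+1) && (nth x (x :: w) i \in B).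
(* Half-open intervals are disjoint, the index being recovered as the integer part of t M; all other
   indices get the empty set. *)
pose F i : set (measurableTypeR R) :=
  if good i && (i < size w)%N then `[i%:R / M, i.+1%:R / M[%classic else set0.
have FM i t : F i t -> [/\ good i, (i < size w)%N & i%:R <= t * M < i.+1%:R].
  rewrite /F; case: ifP => // /andP[gi iw] /=.
  by rewrite in_itv/= ler_pdivrMr// ltr_pdivlMr.
have mF i : measurable (F i) by rewrite /F; case: ifP.
have tF : trivIset setT F.
  move=> i j _ _ [t [/FM[_ _ ti] /FM[_ _ tj]]].
  by rewrite -(truncn_def ti) -(truncn_def tj).
have FB : \big[setU/set0]_(i < size w) F i `<=` unit_itv `&` g @^-1` B.
  rewrite -bigcup_mkord => t [i _ /FM[/andP[/eqP zi zB] iw ti]]; split.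
    case/andP: ti => t1 t2; rewrite /unit_itv/=; apply/andP; split.
      by rewrite -(pmulr_lge0 _ M0) (le_trans _ t1).
    rewrite -(ler_pM2r M0) mul1r (le_trans (ltW t2))// ler_nat//.
  by rewrite /= (gz i t zi ti); exact/set_mem.
have mUB : measurable (unit_itv `&` g @^-1` B : set (measurableTypeR R)).
  by apply: (lip_curve_measurable bX L0 gL) => //; exact: measurable_unit_itv.
have mF' : measurable (\big[setU/set0]_(i < size w) F i) by exact: bigsetU_measurable.
have h : (lambda (\big[setU/set0]_(i < size w) F i) <= nu B)%E.
  by rewrite nuB; apply: (le_measure lambda) FB; rewrite inE.
have hs := measure_bigsetU lambda mF tF (size w).
have {}h : ((\sum_(i < size w) (good i)%:R / M)%:E <= nu B)%E.
  apply: le_trans h; rewrite [leRHS]hs -sumEFin; apply: lee_sum => -[i iw] _ /=.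
  rewrite /F iw andbT; case: ifP => gi; last by rewrite mul0r.
  rewrite [leRHS]lebesgue_measure_itv/= lte_fin ltr_pM2r ?invr_gt0// ltr_nat ltnSn.
  by rewrite -EFinB lee_fin -mulrBl -natrB// subSnn.
rewrite -lee_fin fineK; last exact: fin_num_measure.
by rewrite dwellE natr_sum mulr_suml.
Qed.

End CurveClasses.

(** * Minimisers *)

Section Minimizers.
Context {R : realType} {d0 : measure_display} {X : measurableType d0}.
Variables (dist : X -> X -> R) (K : X -> X -> R).
Hypotheses (Hm : is_metric dist) (cX : dcompact dist) (bX : borel_of_dist dist)
  (cK : continuous_kernel dist K)
  (cellsX : forall del, 0 < del -> exists n a A, cells dist del n a A).
Local Notation lambda := (@lebesgue_measure R).
Let dge0 x y : 0 <= dist x y. Proof. by have [h _ _ _] := Hm. Qed.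
Let dxx x : dist x x = 0. Proof. by have [_ h _ _] := Hm; apply/h. Qed.
Let dsym x y : dist x y = dist y x. Proof. by have [_ _ h _] := Hm. Qed.
Let dtri x y z : dist x z <= dist x y + dist y z.
Proof. by have [_ _ _ h] := Hm. Qed.
Let nsym (x y : R) : `|x - y| = `|y - x|. Proof. exact: distrC. Qed.
Let ntri (x y z : R) : `|x - z| <= `|x - y| + `|y - z|. Proof. exact: ler_distD. Qed.

Definition sqdiscr (mu nu : probability X R) :=
  kint K mu mu - 2 * kint K mu nu + kint K nu nu.

Lemma sqdiscr_close e : 0 < e -> exists2 del, 0 < del &
  forall L g g' rho rho' mu nu nu', 0 <= L ->
    lip_closed_curve dist L g -> lip_closed_curve dist L g' ->
    curve_density L rho -> curve_density L rho' ->
    curve_law g rho nu -> curve_law g' rho' nu' ->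
    (forall t, unit_itv t -> dist (g t) (g' t) <= del) ->
    (forall t, unit_itv t -> `|rho t - rho' t| <= del) ->
    `|sqdiscr mu nu - sqdiscr mu nu'| <= e.
Proof.
move=> e0; have [M M0 KM] := kernel_bounded Hm cX cK.
(* Curve and density each contribute e/12, so means are e/6-close and each energy moves by at most
   e/3; the coefficients 2 and 1 add up to e. *)
have e12 : 0 < e / 12 by lra.
have [del del0 hK] := kernel_ucont Hm cX cK e12.
pose del' := Num.min del (e / 12 / M).
have del'0 : 0 < del' by rewrite lt_min del0 divr_gt0.
exists del' => // L g g' rho rho' mu nu nu' L0 gL gL' cr cr' law law' gg' rr'.
have gg2 t : unit_itv t -> dist (g t) (g' t) <= del.
  by move=> /gg' /le_trans; apply; rewrite ge_min lexx.
have rr2 t : unit_itv t -> `|rho t - rho' t| <= e / 12 / M.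
  by move=> /rr' /le_trans; apply; rewrite ge_min lexx orbT.
have wc := weighted_close bX L0 (ltW e12) (ltW M0) gL gL' cr cr' gg2 rr2.
have MM : M * (e / 12 / M) = e / 12 by rewrite mulrC divfK// gt_eqF.
rewrite MM in wc.
have c1 := mean_contractive Hm cX bX nu; have c2 := mean_contractive Hm cX bX nu'.
have c0 := mean_contractive Hm cX bX mu.
have cl : close_on dist del (e / 12) M (e / 6) (mean nu) (mean nu').
  move=> f uf fmod fM.
  rewrite (curve_mean Hm cX bX cellsX L0 gL cr law uf).
  rewrite (curve_mean Hm cX bX cellsX L0 gL' cr' law' uf).
  by rewrite (le_trans (wc f uf fmod fM))//; lra.
have cl0 : close_on dist del (e / 12) M (e / 6) (mean mu) (mean mu).
  by move=> f _ _ _; rewrite subrr normr0; lra.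
have h1 := kform_close Hm cX cK (ltW del0) hK KM c0 c1 c2 cl0 cl.
have h2 := kform_close Hm cX cK (ltW del0) hK KM c1 c1 c2 cl cl.
rewrite -!(kintE Hm cX bX cK) in h1 h2; rewrite /sqdiscr.
by move: h1 h2; rewrite !ler_norml => /andP[? ?] /andP[? ?]; apply/andP; split; lra.
Qed.

(** Direct method: the ultralimit of a minimising sequence of curves and densities is uniform, so
    all constraints and the energy pass to the limit; the assumption on [S] is its closedness. *)
Lemma curve_class_minimizer (S : (R -> R) -> Prop) L (mu : probability X R) :
  (forall U (rho : nat -> R -> R) rho', UltraFilter U -> (forall n, S (rho n)) ->
    (forall t, unit_itv t -> ulimit U (fun a b => `|a - b|) (rho^~ t) (rho' t)) ->
    S rho') ->
  0 <= L -> (exists nu, curve_class dist S L nu) ->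
  exists2 nu, curve_class dist S L nu &
    forall nu', curve_class dist S L nu' -> discrepancy K mu nu <= discrepancy K mu nu'.
Proof.
move=> hS L0 [nu0 cnu0].
pose D := [set discrepancy K mu nu | nu in [set nu | curve_class dist S L nu]].
have lD : lbound D 0 by move=> _ [nu _ <-]; exact: sqrtr_ge0.
have infD : has_inf D.
  by split; [exists (discrepancy K mu nu0), nu0|exists 0].
have D0 : 0 <= inf D by apply: lb_le_inf lD; exact: infD.1.
have /choice[q hq] (n : nat) : exists q : (R -> X) * (R -> R) * probability X R,
    [/\ lip_closed_curve dist L q.1.1, curve_density L q.1.2, S q.1.2,
        curve_law q.1.1 q.1.2 q.2 & discrepancy K mu q.2 < inf D + n.+1%:R^-1].
  have n0 : 0 < n.+1%:R^-1 :> R by rewrite invr_gt0 ltr0n.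
  have [_ [nu [g [rho [gL cr Sr law]]] <-] h] := inf_adherent n0 infD.
  by exists (g, rho, nu).
have [U [UU Uinf]] := free_ultrafilter.
have /choice[g hg] (t : R) := ulimit_compact UU (fun n => (q n).1.1 t) Hm cX.
have /choice[rho hrho] (t : R) : exists r, unit_itv t ->
    ulimit U (fun a b => `|a - b|) (fun n => (q n).1.2 t) r.
  have [ut|nt] := pselect (unit_itv t); last by exists 0.
  have [|r hr] := @ulimit_real R U UU (fun n => (q n).1.2 t) (1 + L).
    by move=> n; have [_ cr _ _ _] := hq n; exact: density_bound cr ut.
  by exists r.
have gn n s t : unit_itv s -> unit_itv t ->
    dist ((q n).1.1 s) ((q n).1.1 t) <= L * `|s - t|.
  by have [[_ h] _ _ _ _] := hq n; exact: h.
have rn n s t : unit_itv s -> unit_itv t ->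
    `|(q n).1.2 s - (q n).1.2 t| <= L * `|s - t|.
  by have [_ [h _ _] _ _ _] := hq n; exact: h.
have gL : lip_closed_curve dist L g.
  split; last by apply: (ulimit_lipschitz UU dsym dtri gn) => t _; exact: hg.
  have [_ /(_ (g 0) (g 1))[eqd _] _ _] := Hm; apply: eqd.
  apply/eqP; rewrite eq_le dge0 andbT.
  apply: (ulimit_dist_le UU dsym dtri (hg 0) (hg 1)) => e e0.
  apply: filterS filterT => n _ /=; have [[-> _] _ _ _ _] := hq n.
  by rewrite dxx add0r ltW.
have rL s t : unit_itv s -> unit_itv t -> `|rho s - rho t| <= L * `|s - t|.
  exact: (ulimit_lipschitz UU nsym ntri rn hrho).
have gunif := ulimit_uniform UU dsym dtri L0 gn (fun t _ => hg t).
have runif := ulimit_uniform UU nsym ntri L0 rn hrho.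
have rho0 t : unit_itv t -> 0 <= rho t.
  move=> ut; apply/ler_addgt0Pr => e e0.
  have [n /(_ t ut)/= h] := filter_ex (runif e e0).
  have [_ [_ /(_ t ut) h0 _] _ _ _] := hq n.
  by move: h; rewrite ler_norml => /andP[_ h]; lra.
have mU := @measurable_unit_itv R.
have irho := unit_lipschitz_integrable L0 rL.
have rho1 : \int[lambda]_(t in unit_itv) rho t = 1.
  apply/eqP; rewrite -subr_eq0 -normr_eq0 eq_le normr_ge0 andbT.
  apply/ler_addgt0Pr => e e0; rewrite add0r.
  have [n /= h] := filter_ex (runif e e0).
  have [_ cr _ _ _] := hq n; have [_ _ <-] := cr.
  have irn := density_integrable L0 cr.
  rewrite -RintegralB//.
  have id : lambda.-integrable unit_itv (EFin \o (fun t => rho t - (q n).1.2 t)).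
    by apply: eq_integrable (integrableB mU irho irn) => // t _.
  rewrite (le_trans (le_normr_Rintegral mU id))// -[leRHS](unit_Rintegral_cst e).
  apply: le_Rintegral => //; first exact: integrable_norm.
    by apply: (@unit_integrable _ _ `|e|).
  by move=> t ut; rewrite distrC h.
have cr : curve_density L rho by [].
have Sr : S rho by apply: (hS U (fun n => (q n).1.2)) => // n; have [] := hq n.
have [nu law] := curve_law_exists bX L0 gL cr.
exists nu; first by exists g, rho.
suff h : discrepancy K mu nu <= inf D.
  move=> nu' cnu'; apply: le_trans h _; apply: ge_inf; last by exists nu'.
  by exists 0.
have key e : 0 < e -> sqdiscr mu nu <= (inf D + e) ^+ 2 + e.
  move=> e0; have [del del0 hdel] := sqdiscr_close e0.
  have [n [/= h1 [h2 h3]]] := filter_ex (filterI (gunif _ del0)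
    (filterI (runif _ del0) (ultra_small UU Uinf e0))).
  have [gnL crn _ lawn dn] := hq n.
  have := hdel _ _ _ _ _ mu _ _ L0 gnL gL crn cr lawn law h1 h2.
  rewrite ler_norml => /andP[h _].
  (* A negative [sqdiscr] is below any square, so the bound holds for either sign. *)
  have d1 : sqdiscr mu (q n).2 <= discrepancy K mu (q n).2 ^+ 2.
    rewrite /discrepancy -/(sqdiscr _ _); have [q0|q0] := leP 0 (sqdiscr mu (q n).2).
      by rewrite sqr_sqrtr.
    by rewrite (le_trans (ltW q0))// sqr_ge0.
  have d2 : discrepancy K mu (q n).2 ^+ 2 <= (inf D + e) ^+ 2.
    have d3 : 0 <= discrepancy K mu (q n).2 by exact: sqrtr_ge0.
    rewrite lerXn2r ?nnegrE// ?addr_ge0// ?(ltW e0)// (le_trans (ltW dn))// lerD2l.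
    exact: ltW h3.
  have := le_trans d1 d2; lra.
have sq : sqdiscr mu nu <= inf D ^+ 2.
  (* For e' <= 1 the excess 2 e' inf D + e'^2 + e' is at most e' b. *)
  apply/ler_addgt0Pr => e e0; pose b := 2 * inf D + 2.
  have b0 : 0 < b by rewrite /b; lra.
  pose e' := Num.min 1 (e / b).
  have e'0 : 0 < e' by rewrite lt_min ltr01 divr_gt0.
  have e'1 : e' <= 1 by rewrite ge_min lexx.
  have e'b : e' * b <= e by rewrite -ler_pdivlMr// ge_min lexx orbT.
  apply: le_trans (key e' e'0) _; rewrite /b in e'b.
  by rewrite sqrrD; nra.
rewrite /discrepancy -/(sqdiscr _ _) -(ger0_norm D0) -sqrtr_sqr.
by rewrite ler_sqrt// sqr_ge0.
Qed.

End Minimizers.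

(** * Greedy choice for finite quadratic forms *)

Section QuadraticForm.
Context {R : realType}.
Variables (n : nat) (k : nat -> nat -> R) (M : R).
Hypotheses (ksym : forall i j, k i j = k j i) (kM : forall i j, `|k i j| <= M).

Definition bform (u v : nat -> R) : R := \sum_(i < n) \sum_(j < n) u i * v j * k i j.
Local Notation qform u := (bform u u).
Hypothesis kpos : forall u, 0 <= qform u.

Lemma bformC u v : bform u v = bform v u.
Proof.
rewrite /bform exchange_big/=; apply: eq_bigr => i _; apply: eq_bigr => j _.
by rewrite ksym (mulrC (u _)).
Qed.

Lemma bformDr u v w : bform u (fun i => v i + w i) = bform u v + bform u w.
Proof.
rewrite /bform -big_split/=; apply: eq_bigr => i _; rewrite -big_split/=.
by apply: eq_bigr => j _; rewrite mulrDr mulrDl.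
Qed.

Lemma bformZr c u v : bform u (fun i => c * v i) = c * bform u v.
Proof.
rewrite /bform mulr_sumr; apply: eq_bigr => i _; rewrite mulr_sumr.
by apply: eq_bigr => j _; rewrite mulrCA !mulrA.
Qed.

Lemma bform_sumr u m (c : nat -> R) (v : nat -> nat -> R) :
  bform u (fun i => \sum_(l < m) c l * v l i) = \sum_(l < m) c l * bform u (v l).
Proof.
elim: m => [|m IHm].
  rewrite big_ord0 /bform big1// => i _; rewrite big1// => j _.
  by rewrite big_ord0 mulr0 mul0r.
rewrite big_ord_recr/= -IHm -bformZr -bformDr; congr bform.
by apply/funext => i; rewrite big_ord_recr.
Qed.

Lemma qformD u v : qform (fun i => u i + v i) = qform u + 2 * bform u v + qform v.
Proof.
rewrite bformDr !(bformC (fun i => u i + v i)) !bformDr (bformC v u); ring.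
Qed.

Lemma qformZ c u : qform (fun i => c * u i) = c ^+ 2 * qform u.
Proof. by rewrite bformZr bformC bformZr mulrA expr2. Qed.

(** Parallelogram law, with the nonnegative form of u - v dropped. *)
Lemma qformD_le u v : qform (fun i => u i + v i) <= 2 * qform u + 2 * qform v.
Proof.
have := kpos (fun i => u i + (-1) * v i).
rewrite qformD qformD bformZr qformZ; lra.
Qed.

Lemma bform_le u v : `|bform u v| <= M * (\sum_(i < n) `|u i|) * (\sum_(j < n) `|v j|).
Proof.
rewrite (le_trans (ler_norm_sum _ _ _))// mulrAC mulr_sumr ler_sum// => i _.
rewrite (le_trans (ler_norm_sum _ _ _))// mulr_sumr mulr_suml ler_sum// => j _.
rewrite !normrM mulrC -!mulrA ler_pM// ?mulr_ge0// mulrC//.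
Qed.

Variable p : nat -> R.
Hypotheses (p0 : forall i, (i < n)%N -> 0 <= p i) (p1 : \sum_(i < n) p i = 1).

(** Both c p and r are nonnegative of total mass c, so their difference has l1-norm at most 2 c. *)
Lemma qform_diff_le c r : 0 <= c -> (forall i, (i < n)%N -> 0 <= r i) ->
  \sum_(i < n) r i = c -> qform (fun i => c * p i + (-1) * r i) <= 4 * M * c ^+ 2.
Proof.
move=> c0 r0 r1; rewrite (le_trans (ler_norm _))// (le_trans (bform_le _ _))//.
have : \sum_(i < n) `|c * p i + (-1) * r i| <= 2 * c.
  apply: (@le_trans _ _ (\sum_(i < n) (c * p i + r i))).
    apply: ler_sum => i _; rewrite (le_trans (ler_normD _ _))// mulN1r normrN.
    by rewrite !ger0_norm ?mulr_ge0 ?p0 ?r0.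
  by rewrite big_split/= -mulr_sumr p1 r1; lra.
have : 0 <= \sum_(i < n) `|c * p i + (-1) * r i| by apply: sumr_ge0.
have M0 : 0 <= M by rewrite (le_trans _ (kM 0 0)).
move: (\sum_(i < n) _) => S S0 S2; rewrite -mulrA -expr2.
rewrite (_ : 4 * M * c ^+ 2 = M * (2 * c) ^+ 2); last by ring.
by rewrite ler_wpM2l// lerXn2r// nnegrE; lra.
Qed.

(* Greedy herding: averaging [bform u (p - delta_i)] against [p] gives [0], so some index
   keeps the cross term nonpositive and the form grows at most linearly. *)
Lemma herding N : exists s : seq nat, [/\ size s = N, all (fun i => i < n)%N s &
  qform (fun i => N%:R * p i + (-1) * (count_mem i s)%:R) <= 4 * M * N%:R].
Proof.
elim: N => [|N [s [sN sn hs]]].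
  exists [::]; split => //; rewrite /bform big1 => [|i _]; first by rewrite mulr0.
  by rewrite big1// => j _; rewrite !(mul0r, mulr0, addr0).
pose u i : R := N%:R * p i + (-1) * (count_mem i s)%:R.
pose e (i j : nat) : R := (i == j)%:R.
have eE j : (j < n)%N -> \sum_(l < n) p l * e l j = p j.
  move=> jn; rewrite (bigD1 (Ordinal jn))//= /e eqxx mulr1 big1 ?addr0// => l.
  by rewrite -val_eqE /= => /negbTE ->; rewrite mulr0.
(* Half the cross term created by choosing i next; the factors 1 and -1 give the increment the shape
   of [qform_diff_le] at c = 1. *)
pose b i := bform u (fun j => 1 * p j + (-1) * e i j).
have sb : \sum_(l < n) p l * b l = 0.
  have -> : \sum_(l < n) p l * b l =
      (\sum_(l < n) p l) * bform u p - \sum_(l < n) p l * bform u (e l).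
    rewrite mulr_suml -sumrB; apply: eq_bigr => l _.
    by rewrite /b bformDr !bformZr; ring.
  rewrite p1 mul1r -bform_sumr; apply/eqP; rewrite subr_eq0; apply/eqP.
  by apply: eq_bigr => i _; apply: eq_bigr => j _; rewrite eE.
have [i iN bi] : exists2 i, (i < n)%N & b i <= 0.
  apply: contrapT => nb.
  have bpos i : (i < n)%N -> 0 < b i.
    by move=> iN; rewrite ltNge; apply/negP => bi; apply: nb; exists i.
  (* If all [b i] were positive, the vanishing p-average of [b] would force p = 0, against total
     mass 1. *)
  have pz (l : 'I_n) : p l = 0.
    have pb0 (l' : 'I_n) : true -> 0 <= p l' * b l'.
      by move=> _; rewrite mulr_ge0 ?p0// ltW ?bpos.
    have /eqP : p l * b l = 0 by exact: (psumr_eq0P pb0 sb).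
    rewrite mulf_eq0 => /orP[/eqP//|].
    by rewrite gt_eqF ?bpos.
  by move: p1; rewrite big1 => [/eqP|l _]; rewrite ?pz// eq_sym oner_eq0.
exists (i :: s); split; [by rewrite /= sN|by rewrite /= iN|].
have -> : (fun j => N.+1%:R * p j + -1 * (count_mem j (i :: s))%:R) =
    (fun j => u j + (1 * p j + (-1) * e i j)).
  by apply/funext => j; rewrite /u /e /= natrD -natr1; ring.
have he : qform (fun j => 1 * p j + (-1) * e i j) <= 4 * M * 1 ^+ 2.
  apply: qform_diff_le => //.
  rewrite (bigD1 (Ordinal iN))//= /e eqxx big1 => [|l]; first by rewrite addr0.
  by rewrite -val_eqE /= eq_sym => /negbTE ->.
by rewrite qformD -natr1; move: bi he hs; rewrite -/u -/(b i) expr1n; lra.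
Qed.

(* [theta] is the fraction of time spent at each visit, and [v] the resulting weights. *)
Lemma qform_dwell N s theta v : (0 < N)%N -> size s = N -> all (fun i => i < n)%N s ->
  qform (fun i => N%:R * p i + (-1) * (count_mem i s)%:R) <= 4 * M * N%:R ->
  0 <= theta -> (forall i, (i < n)%N -> theta * (count_mem i s)%:R <= v i) ->
  \sum_(i < n) v i = 1 ->
  theta * N%:R <= 1 /\
  qform (fun i => p i + (-1) * v i) <=
    8 * M / N%:R + 8 * M * (1 - theta * N%:R) ^+ 2.
Proof.
move=> N0 sN sn hs t0 tv v1.
have cs : \sum_(i < n) (count_mem (i : nat) s)%:R = N%:R :> R.
  rewrite -natr_sum; congr (_%:R); rewrite -sN {tv hs sN}.
  elim: s sn => [|i s IHs] /=; first by rewrite big1.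
  move=> /andP[iN /IHs {}IHs]; rewrite big_split/= IHs -add1n; congr addn.
  rewrite (bigD1 (Ordinal iN))//= eqxx big1 => [|l]; first by rewrite addn0.
  by rewrite -val_eqE /= eq_sym => /negbTE ->.
pose r i := v i - theta * (count_mem i s)%:R.
have r0 i : (i < n)%N -> 0 <= r i by move=> iN; rewrite subr_ge0 tv.
have r1 : \sum_(i < n) r i = 1 - theta * N%:R by rewrite sumrB v1 -mulr_sumr cs.
have del0 : 0 <= 1 - theta * N%:R by rewrite -r1; apply: sumr_ge0 => i _; exact: r0.
split; first by rewrite -subr_ge0.
have M0 : 0 <= M by rewrite (le_trans _ (kM 0 0)).
have NR : 0 < N%:R :> R by rewrite ltr0n.
have h := qform_diff_le del0 r0 r1.
(* Split into theta times the herding error plus the travel part of mass 1 - theta N; as theta N <=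
   1, the first contributes at most 2 (4 M / N). *)
have -> : (fun i => p i + -1 * v i) = (fun i =>
   theta * (N%:R * p i + (-1) * (count_mem i s)%:R) +
   ((1 - theta * N%:R) * p i + (-1) * r i)).
  by apply/funext => i; rewrite /r; ring.
rewrite (le_trans (qformD_le _ _))// qformZ.
have : theta ^+ 2 * qform (fun i => N%:R * p i + -1 * (count_mem i s)%:R) <= 4 * M / N%:R.
  apply: (@le_trans _ _ (theta ^+ 2 * (4 * M * N%:R))).
    by rewrite ler_wpM2l// sqr_ge0.
  rewrite ler_pdivlMr//.
  have -> : theta ^+ 2 * (4 * M * N%:R) * N%:R = 4 * M * (theta * N%:R) ^+ 2 by ring.
  rewrite ler_piMr ?mulr_ge0// expr_le1// ?mulr_ge0 ?ler0n//; lra.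
have -> : 8 * M / N%:R = 2 * (4 * M / N%:R) by ring.
by move: h; lra.
Qed.

End QuadraticForm.

(** * The rate *)

Section Rate.
Context {R : realType} {d0 : measure_display} {X : measurableType d0}.
Variables (dist : X -> X -> R) (K : X -> X -> R).
Hypotheses (Hm : is_metric dist) (cX : dcompact dist) (bX : borel_of_dist dist)
  (lX : length_space dist) (cK : continuous_kernel dist K)
  (sK : symmetric_kernel K) (pK : pos_def_kernel K).
Variable M : R.
Hypotheses (M0 : 0 < M) (KM : forall x y, `|K x y| <= M).

Lemma sqdiscr_le mu nu : sqdiscr K mu nu <= 4 * M.
Proof.
have h (m1 m2 : probability X R) : `|kint K m1 m2| <= M.
  have bnd (m : probability X R) f : ucont dist f -> (forall x, `|f x| <= M) -> `|mean m f| <= M.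
    move=> uf fM; have [l0 cl] := mean_contractive Hm cX bX m.
    have := cl f (fun=> 0) M uf (@ucont_const _ _ _ dist 0).
    by rewrite l0 subr0; apply => x; rewrite subr0.
  rewrite (kintE Hm cX bX cK); apply: (bnd).
    by apply: (ucont_potential Hm cX cK); exact: mean_contractive.
  by move=> x; apply: bnd => //; exact: (ucont_kernel Hm cX cK).
rewrite /sqdiscr; have := h mu mu; have := h mu nu; have := h nu nu.
by rewrite !ler_norml => /andP[? ?] /andP[? ?] /andP[? ?]; lra.
Qed.

(** Passing to cells costs 2 e for each of the three energies, which enter with weights 1, 2 and
    1. *)
Lemma sqdiscr_cells e del n a A mu nu : 0 < del -> kernel_modulus dist K del e ->
  cells dist del n a A ->
  sqdiscr K mu nu <= 8 * e +
    bform n (fun i j => K (a i) (a j)) (fun i => fine (mu (A i)) + (-1) * fine (nu (A i)))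
      (fun i => fine (mu (A i)) + (-1) * fine (nu (A i))).
Proof.
move=> del0 hK cA.
have h m1 m2 := kint_cells Hm cX bX cK m1 m2 del0 hK cA.
have := h mu mu; have := h mu nu; have := h nu nu.
rewrite qformD ?qformZ ?bformZr => //; rewrite /sqdiscr /bform.
by rewrite !ler_norml => /andP[? ?] /andP[? ?] /andP[? ?]; lra.
Qed.

(** Two scales are at work: cells of size [del] only discretise the energies, with loss 8 M / N,
    while the net of mesh [e] carries the walk and fixes L. *)
Lemma curve_rate N J e P L mu : (0 < N)%N -> (0 < J)%N -> 0 < e -> net dist e P ->
  (forall del, 0 < del -> exists n a A, cells dist del n a A) ->
  3 * e * (2 * size P + N * J.+2)%:R <= L ->
  exists2 nu, Lcurve dist L nu & sqdiscr K mu nu <=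
    16 * M / N%:R + 8 * M * ((2 * size P + 2 * N)%:R / (N * J)%:R) ^+ 2.
Proof.
move=> N0 J0 e0 netP cellsX leL.
have NR : 0 < N%:R :> R by rewrite ltr0n.
have eps0 : 0 < M / N%:R by rewrite divr_gt0.
have [del del0 hK] := kernel_ucont Hm cX cK eps0.
have [n [a [A cA]]] := cellsX _ del0; have [mA _ aA _ _] := cA.
pose k i j := K (a i) (a j).
have ksym i j : k i j = k j i by exact: sK.
have kM i j : `|k i j| <= M by exact: KM.
have kpos u : 0 <= bform n k u u by exact: (pK (fun i : 'I_n => a i) (fun i => u i)).
pose p i := fine (mu (A i)).
have p0 i : (i < n)%N -> 0 <= p i by move=> _; exact: fine_ge0.
have p1 : \sum_(i < n) p i = 1 by exact: cells_sum1 cA.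
have [s [sN sn hs]] := herding ksym kM p0 p1 N.
have [x0 [w [cw w0 sw dw]]] := net_walk Hm cX (map a s) J lX e0 netP.
rewrite size_map sN in w0 sw; have {}w0 := w0 J0 N0.
have l0 : 0 <= 3 * e by lra.
have [|nu nuL nuB] := walk_law Hm cX bX (L := L) lX l0 w0 cw.
  by apply: le_trans leL; rewrite ler_wpM2l// ler_nat.
exists nu => //.
have WR : 0 < (size w)%:R :> R by rewrite ltr0n.
pose theta : R := J%:R / (size w)%:R.
have theta0 : 0 <= theta by rewrite divr_ge0.
have tv i : (i < n)%N -> theta * (count_mem i s)%:R <= fine (nu (A i)).
  move=> iN; apply: le_trans (nuB _ (mA i)).
  rewrite /theta mulrAC ler_wpM2r ?invr_ge0 ?(ltW WR)// -natrM ler_nat.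
  apply: leq_trans (dw (A i)); rewrite leq_mul2l count_map; apply/orP; right.
  by apply: sub_count => j /eqP ->; rewrite /= inE; exact: aA.
have [tN hq] := qform_dwell ksym kM kpos p0 p1 N0 sN sn hs theta0 tv (cells_sum1 _ cA).
apply: le_trans (sqdiscr_cells _ _ del0 hK cA) _.
apply: (@le_trans _ _ (8 * (M / N%:R) + (8 * M / N%:R + 8 * M * (1 - theta * N%:R) ^+ 2))).
  by rewrite lerD2l.
have -> : 16 * M / N%:R = 8 * (M / N%:R) + 8 * M / N%:R by ring.
rewrite -addrA lerD2l lerD2l ler_wpM2l ?mulr_ge0 ?(ltW M0)//.
have NJ0 : 0 < (N * J)%:R :> R by rewrite ltr0n muln_gt0 N0.
(* The travel fraction is (size w - N J) / size w: the numerator is at most 2 size P + 2 N, and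
   theta N <= 1 makes the denominator at least N J. *)
have WNJ : (N * J)%:R <= (size w)%:R :> R.
  by move: tN; rewrite /theta mulrAC ler_pdivrMr// mul1r natrM mulrC.
rewrite lerXn2r ?nnegrE ?divr_ge0 ?subr_ge0// /theta.
have -> : 1 - J%:R / (size w)%:R * N%:R = ((size w)%:R - (N * J)%:R) / (size w)%:R :> R.
  by rewrite natrM; field; rewrite gt_eqF.
apply: ler_pM; rewrite ?subr_ge0 ?invr_ge0 ?(ltW WR)//; last by rewrite lef_pV2.
by rewrite lerBlDr -natrD ler_nat; apply: leq_trans sw _; rewrite !mulnS; clear; lia.
Qed.

Variables (sigma : {finite_measure set X -> \bar R}) (d : R).
Hypotheses (d_gt0 : 0 < d) (aX : ahlfors_regular dist sigma d).

Lemma exists_cells del : 0 < del -> exists n a A, cells dist del n a A.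
Proof.
move=> del0; have [C C0 hC] := exists_net Hm cX bX d_gt0 aX.
have e0 : 0 < Num.min del 1 <= 1 by rewrite lt_min del0 ltr01/= ge_min lexx orbT.
have [P netP _] := hC _ e0; have e0' := andP e0.
have [A [mA tA aA diamA cov]] := net_cells Hm bX (ltW e0'.1) netP.
exists (size P), (nth point P), A; split => // i x iP Aix.
by rewrite (le_trans (diamA _ _ iP Aix))// ge_min lexx.
Qed.

Lemma powR_half_split (x r : R) : 0 < x -> x * Num.sqrt x * x `^ r = x `^ (3 / 2 + r).
Proof.
move=> x0; rewrite -powR12_sqrt ?ltW// -{1}[x]powRr1 ?ltW// -!powRD.
- by congr powR; field.
- by apply/implyP => _; rewrite gt_eqF.
- by apply/implyP => _; rewrite gt_eqF.
Qed.

Lemma curve_rate_points : exists C1 C2 : R, [/\ 0 < C1, 0 < C2 &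
  forall N L mu, (0 < N)%N -> C1 * N%:R `^ (3 / 2 - d^-1) <= L ->
    exists2 nu, Lcurve dist L nu & sqdiscr K mu nu <= C2 / N%:R].
Proof.
have [C C0 hC] := exists_net Hm cX bX d_gt0 aX.
(* With e = N^(-1/d) the net has at most C N points, and J + 2 <= 4 sqrt N. So the Lipschitz
   constant is at most 3 e (2 C + 4) N^(3/2), and the travel fraction at most (2 C + 2) / sqrt N. *)
exists (6 * C + 12), (16 * M + 8 * M * (2 * C + 2) ^+ 2); split.
- by lra.
- by rewrite ltr_pwDl ?mulr_gt0// mulr_ge0 ?sqr_ge0// mulr_ge0// ltW.
move=> N L mu N0 leL.
have NR : 0 < N%:R :> R by rewrite ltr0n.
have N1 : 1 <= N%:R :> R by rewrite ler1n.
pose e : R := N%:R `^ (- d^-1); have e0 : 0 < e by exact: powR_gt0.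
have e1 : e <= 1.
  rewrite /e powRN invf_le1 ?powR_gt0//.
  have : 1 `^ d^-1 <= N%:R `^ d^-1 :> R.
    by apply: ge0_ler_powR; rewrite ?nnegrE ?invr_ge0 ?(ltW d_gt0).
  by rewrite powR1.
have e01 : 0 < e <= 1 by rewrite e0 e1.
have [P netP] := hC e e01.
have -> : e `^ (- d) = N%:R.
  by rewrite /e -powRrM mulrNN mulVf ?gt_eqF// powRr1// ltW.
move=> sP.
pose J := (Num.truncn (Num.sqrt N%:R : R)).+1.
have sN1 : 1 <= Num.sqrt N%:R :> R by rewrite -[leLHS]sqrtr1 ler_sqrt // (lt_le_trans ltr01).
have sN0 : 0 <= Num.sqrt N%:R :> R by exact: sqrtr_ge0.
have /andP[J1 J2] := truncn_itv sN0; rewrite -/J in J2.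
have JS : J%:R <= Num.sqrt N%:R + 1 :> R by rewrite /J -natr1 lerD2r.
have sqN : Num.sqrt N%:R * Num.sqrt N%:R = N%:R :> R by rewrite -expr2 sqr_sqrtr// ltW.
have [|nu nuL hnu] := @curve_rate N J e P L mu N0 isT e0 netP exists_cells.
  apply: le_trans leL; rewrite -(powR_half_split _ NR) -/e.
  rewrite natrD !natrM -addn2 natrD.
  have : 2 * (size P)%:R + N%:R * (J%:R + 2) <= (2 * C + 4) * (N%:R * Num.sqrt N%:R).
    have h1 : C * N%:R <= C * (N%:R * Num.sqrt N%:R).
      by rewrite ler_wpM2l ?(ltW C0)// ler_peMr// ltW.
    have h2 : N%:R * (J%:R + 2) <= N%:R * (4 * Num.sqrt N%:R) :> R.
      by rewrite ler_wpM2l ?(ltW NR)//; move: JS sN1; lra.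
    rewrite [leRHS](_ : _ = 2 * (C * (N%:R * Num.sqrt N%:R)) +
      N%:R * (4 * Num.sqrt N%:R)); last by ring.
    by move: sP h1 h2; lra.
  move=> h; rewrite [leRHS](_ : _ = 3 * e * ((2 * C + 4) * (N%:R * Num.sqrt N%:R))); last by ring.
  by rewrite ler_wpM2l//; lra.
exists nu => //; apply: le_trans hnu _; rewrite [leRHS]mulrDl lerD2l -[leRHS]mulrA ler_wpM2l//.
  by rewrite mulr_ge0// ltW.
have NJ0 : 0 < (N * J)%:R :> R by rewrite ltr0n muln_gt0 N0.
have h : (2 * size P + 2 * N)%:R / (N * J)%:R <= (2 * C + 2) / Num.sqrt N%:R :> R.
  have r0 : 0 < Num.sqrt N%:R :> R by lra.
  rewrite ler_pdivrMr// mulrAC ler_pdivlMr// natrM natrD !natrM.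
  apply: (@le_trans _ _ ((2 * C + 2) * N%:R * Num.sqrt N%:R)).
    by rewrite ler_wpM2r//; lra.
  by rewrite -!mulrA ler_wpM2l ?addr_ge0 ?mulr_ge0 ?(ltW C0)// ler_wpM2l// ltW.
have -> : (2 * C + 2) ^+ 2 / N%:R = ((2 * C + 2) / Num.sqrt N%:R) ^+ 2 :> R.
  by rewrite expr_div_n sqr_sqrtr// ltW.
by rewrite lerXn2r// nnegrE divr_ge0//; lra.
Qed.

Lemma constant_Lcurve L : 0 <= L -> exists nu, Lcurve dist L nu.
Proof.
move=> L0; have gL : lip_closed_curve dist L (fun=> point).
  split => // s t _ _; have [_ /(_ point point)[_ ->//] _ _] := Hm.
  by rewrite mulr_ge0.
have [nu law] := curve_law_exists bX L0 gL (unit_density L0).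
by exists nu; apply/(LcurveP bX) => //; exists (fun=> point), (fun=> 1); split => //; exact: unit_density.
Qed.

Lemma Lcurve_rate : exists2 c : R, 0 < c & forall mu L, 1 <= L ->
  exists2 nu, Lcurve dist L nu & discrepancy K mu nu <= c * L `^ (- (d / (3 * d - 2))).
Proof.
pose beta := d / (3 * d - 2).
have triv mu nu : discrepancy K mu nu <= Num.sqrt (4 * M).
  by rewrite /discrepancy ler_sqrt ?mulr_ge0 ?(ltW M0)//; exact: sqdiscr_le.
have s0 : 0 < Num.sqrt (4 * M) by rewrite sqrtr_gt0 mulr_gt0.
(* For 3 d <= 2 the exponent of L is nonnegative (at equality, division by zero makes it 0), so the
   trivial bound suffices. *)
have [d23|d23] := leP (3 * d) 2.
  exists (Num.sqrt (4 * M)) => // mu L L1.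
  have [nu nuL] := constant_Lcurve (le_trans ler01 L1).
  exists nu => //; apply: le_trans (triv mu nu) _; rewrite ler_peMr ?(ltW s0)//.
  rewrite -[leLHS](powRr0 L); apply: ler_powR => //.
  by rewrite oppr_ge0 mulr_ge0_le0 ?(ltW d_gt0)// invr_le0 subr_le0.
have [C1 [C2 [C10 C20 rate]]] := curve_rate_points.
have beta0 : 0 < beta by rewrite divr_gt0//; lra.
have C1b : 0 < C1 `^ beta by exact: powR_gt0.
have s2 : 0 <= Num.sqrt (2 * C2) by exact: sqrtr_ge0.
(* The first summand covers L < C1 by the trivial bound, the second covers L >= C1; the factor
   C1^beta rescales L to L / C1. *)
exists ((Num.sqrt (4 * M) + Num.sqrt (2 * C2)) * C1 `^ beta).
  by rewrite mulr_gt0// ltr_wpDr.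
move=> mu L L1; have L0 : 0 < L by rewrite (lt_le_trans ltr01).
have CL : C1 `^ beta * L `^ (- beta) = (L / C1) `^ (- beta).
  have C1i : 0 <= C1^-1 by rewrite invr_ge0 ltW.
  rewrite (powRM _ (ltW L0) C1i) mulrC; congr (_ * _).
  by rewrite -powR_inv1 ?(ltW C10)// -powRrM mulN1r opprK.
rewrite -mulrA CL.
have x0 : 0 < L / C1 by rewrite divr_gt0.
have [LC|CL1] := ltP (L / C1) 1.
  have [nu nuL] := constant_Lcurve (ltW L0); exists nu => //.
  apply: le_trans (triv mu nu) _.
  have : 1 <= (L / C1) `^ (- beta).
    rewrite powRN invf_ge1 ?powR_gt0//.
    have : (L / C1) `^ beta <= 1 `^ beta.
      by apply: ge0_ler_powR; rewrite ?nnegrE ?(ltW x0) ?(ltW LC) ?(ltW beta0).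
    by rewrite powR1.
  by nra.
(* N is the integer part of y. Since 2 beta (3/2 - 1/d) = 1, the Lipschitz budget C1 N^(3/2 - 1/d)
   is at most L. *)
pose y := (L / C1) `^ (2 * beta).
have y1 : 1 <= y.
  have : 1 `^ (2 * beta) <= y.
    by apply: ge0_ler_powR; rewrite ?nnegrE ?(ltW x0)// mulr_ge0// ltW.
  by rewrite powR1.
have y0 : 0 <= y by lra.
have /andP[Ny yN] := truncn_itv y0; set N := Num.truncn y in Ny yN.
have N0 : (0 < N)%N by rewrite -ltnS -(ltr_nat R); lra.
have N1 : 1 <= N%:R :> R by rewrite ler1n.
have alpha0 : 0 < 3 / 2 - d^-1.
  have -> : 3 / 2 - d^-1 = (3 * d - 2) / (2 * d) by field; rewrite gt_eqF.
  by rewrite divr_gt0//; lra.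
have [|nu nuL hnu] := rate N L mu N0.
  rewrite mulrC -ler_pdivlMr//.
  apply: (@le_trans _ _ (y `^ (3 / 2 - d^-1))).
    by apply: ge0_ler_powR; rewrite ?nnegrE// ltW.
  rewrite /y -powRrM (_ : 2 * beta * _ = 1) ?powRr1 ?(ltW x0)//.
  rewrite /beta; field; apply/andP; split; rewrite gt_eqF//; lra.
exists nu => //.
have yinv : (L / C1) `^ (- beta) = Num.sqrt y^-1.
  by rewrite -powR12_sqrt ?invr_ge0// /y -powRN -powRrM; congr powR; field.
have h : sqdiscr K mu nu <= 2 * C2 * y^-1.
  have yp : 0 < y by rewrite (lt_le_trans ltr01).
  have Np : 0 < N%:R :> R by rewrite ltr0n.
  (* Rounding down loses at most a factor 2, as N >= 1; hence C2 / N <= 2 C2 / y. *)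
  have yN2 : y <= N%:R + N%:R.
    by rewrite (le_trans (ltW yN))// -[leLHS]natr1 lerD2l.
  apply: le_trans hnu _; rewrite ler_pdivlMr// mulrAC ler_pdivrMr//.
  rewrite (_ : 2 * C2 * N%:R = C2 * (N%:R + N%:R)); last by ring.
  by rewrite ler_wpM2l// ltW.
apply: (@le_trans _ _ (Num.sqrt (2 * C2) * Num.sqrt y^-1)).
  rewrite -sqrtrM ?mulr_ge0 ?(ltW C20)//.
  by rewrite /discrepancy ler_sqrt// !mulr_ge0 ?invr_ge0 ?(ltW C20).
by rewrite yinv ler_wpM2r ?sqrtr_ge0// lerDr ltW.
Qed.

End Rate.

(** * Existence of both minimisers combined with the rate *)

Theorem theorem2 (R : realType) (d0 : measure_display) (X : measurableType d0)
  (dist : X -> X -> R) (sigma : {finite_measure set X -> \bar R}) (d : R)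
  (K : X -> X -> R) :
  is_metric dist -> dcompact dist -> borel_of_dist dist ->
  full_support dist sigma -> 0 < d -> ahlfors_regular dist sigma d ->
  length_space dist ->
  continuous_kernel dist K -> symmetric_kernel K -> pos_def_kernel K ->
  exists2 c : R, 0 < c &
    forall (mu : probability X R) (L : R), 1 <= L ->
      exists nuA nuL : probability X R,
        [/\ Acurve dist L nuA,
            (forall nu, Acurve dist L nu -> discrepancy K mu nuA <= discrepancy K mu nu),
            Lcurve dist L nuL,
            (forall nu, Lcurve dist L nu -> discrepancy K mu nuL <= discrepancy K mu nu) &
            discrepancy K mu nuA <= discrepancy K mu nuL <= c * L `^ (- (d / (3 * d - 2)))].
Proof.
move=> Hm cX bX _ d_gt0 aX lX cK sK pK.
have [M M0 KM] := kernel_bounded Hm cX cK.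
have [c c0 rate] := Lcurve_rate Hm cX bX lX cK sK pK M0 KM d_gt0 aX.
exists c => // mu L L1; have L0 : 0 <= L by rewrite (le_trans ler01).
have cellsX := exists_cells Hm cX bX d_gt0 aX.
have [nu0 nu0L nu0c] := rate mu L L1.
(* The constant density 1 is admissible for [Acurve]; this inclusion gives the first inequality
   between the minima. *)
have LA nu : Lcurve dist L nu -> Acurve dist L nu.
  move=> /(LcurveP bX _ L0)[g [rho [gL cr _ law]]].
  by apply/(AcurveP dist _ L0); exists g, rho.
have [||nuA /(AcurveP dist _ L0) nuAA minA] :=
    @curve_class_minimizer _ _ _ _ _ Hm cX bX cK cellsX (fun=> True) L mu _ L0.
- by [].
- by exists nu0; apply/(AcurveP dist _ L0); exact: LA.
have [||nuL /(LcurveP bX _ L0) nuLL minL] := @curve_class_minimizer _ _ _ _ _ Hm cX bX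
    cK cellsX (fun rho => forall t, unit_itv t -> rho t = 1) L mu _ L0.
(* Being equal to 1 on [0,1] is preserved under pointwise ultralimits. *)
- move=> U rho rho' UU rho1 lim t ut; apply/eqP; rewrite -subr_eq0 -normr_eq0.
  rewrite eq_le normr_ge0 andbT; apply/ler_addgt0Pr => e e0; rewrite add0r.
  have [n] := filter_ex (lim t ut e e0).
  by rewrite /= rho1// distrC => /ltW.
- by exists nu0; apply/(LcurveP bX _ L0).
exists nuA, nuL; split => //.
- by move=> nu nuA'; apply: minA; apply/(AcurveP dist _ L0).
- by move=> nu nuL'; apply: minL; apply/(LcurveP bX _ L0).
- rewrite minA ?(le_trans _ nu0c)//; last by apply/(AcurveP dist _ L0); exact: LA.
  by apply: minL; apply/(LcurveP bX _ L0).
Qed.
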